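(* Let $2<p<\infty$ and $\alpha=(p-2)/p$. Let $X_1,\dots,X_m$ be a finite nonzero family of analytic polynomials, and assume each $|X_j|^2$ (on $\mathbb T$) has trigonometric degree at most $D$. If $\mathscr C_\infty>0$, then $$1-\frac{\mathscr C_K^2}{\mathscr C_\infty^2}\lesssim_p\min\left\{1,\left[\sqrt{\frac{D+1}{K}}\,\log\bigl(eK(D+1)\bigr)\right]^\alpha\right\}$$ for every integer $K\ge1$. Hence, up to the displayed logarithmic factor, $K\gtrsim_p(D+1)\eta^{-2p/(p-2)}$ captures the squared norm with relative error at most $\eta$.
   Context: $\mathbb T$ is the unit circle with normalized Haar measure, $\mathbb D$ the open unit disc, and $H^u$ the Hardy space, identified with boundary functions on $\mathbb T$; $\|\cdot\|_u$ is the norm of $L^u(\mathbb T)$; $t=2p/(p-2)$. For $a\in\mathbb D$, $P_a(\zeta)=\frac{1-|a|^2}{|1-\overline a\zeta|^2}$ is the Poisson kernel. For an integer $K\ge1$, $\mathcal A_K$ is the set of outer functions $h\in H^t$ with $|h|^t=\sum_{\nu=1}^Kc_\nu P_{a_\nu}$ on $\mathbb T$ for some $a_\nu\in\mathbb D$, $c_\nu\ge0$, $\sum_{\nu=1}^K c_\nu=1$. Define $\mathscr C_K=\sup_{h\in\mathcal A_K}\bigl(\sum_{j=1}^m\|X_jh\|_2^t\bigr)^{1/t}$, and let $\mathscr C_\infty$ be the norm of the map $h\mapsto(X_jh)_{j=1}^m$ from $H^t$ to $\ell^t(H^2)$, that is, $\mathscr C_\infty=\sup_{\|h\|_{H^t}\le1}\bigl(\sum_{j=1}^m\|X_jh\|_2^t\bigr)^{1/t}$.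 The symbols $\lesssim_p$ and $\gtrsim_p$ denote inequalities up to a constant depending only on $p$. *)

(* Defs.v *)
(* Mathematical Components with MathComp-Analysis; complex numbers are R[i]. *)
From HB Require Import structures.
From mathcomp Require Import all_boot all_order all_algebra.
From mathcomp Require Import complex.
From mathcomp Require Import all_classical all_reals all_analysis.

Set Implicit Arguments.
Unset Strict Implicit.
Unset Printing Implicit Defensive.

Import Order.TTheory GRing.Theory Num.Theory.
Import ComplexField.Normc.

Local Open Scope classical_set_scope.
Local Open Scope ring_scope.
Local Open Scope complex_scope.

Lemma twopi_gt0 (R : realType) : 0 < 2 * pi :> R.
Proof. by rewrite mulr_gt0// pi_gt0. Qed.

(* Normalized Haar measure of the circle, in the angular coordinate: the uniform
   probability on [0, 2 pi].  A function on the circle is given by any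
   f : R[i] -> R[i]; every notion below depends only on its values at the points
   [circ x], and only up to a null set. *)
Definition haarT (R : realType) : probability (measurableTypeR R) R :=
  uniform_prob (twopi_gt0 R).

Definition circ (R : realType) (x : R) : R[i] := cos x +i* sin x.

Definition cexp (R : realType) (z : R[i]) : R[i] :=
  (expR (complex.Re z))%:C * circ (complex.Im z).

Definition intT (R : realType) (f : R[i] -> R[i]) : R[i] :=
  (\int[haarT R]_x complex.Re (f (circ x))) +i* (\int[haarT R]_x complex.Im (f (circ x))).

Definition normT (R : realType) (u : R) (f : R[i] -> R[i]) : \bar R :=
  Lnorm (haarT R) u%:E (fun x => (normc (f (circ x)))%:E).

Definition measT (R : realType) (f : R[i] -> R[i]) : Prop :=
  measurable_fun [set: measurableTypeR R] (fun x => complex.Re (f (circ x))) /\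
  measurable_fun [set: measurableTypeR R] (fun x => complex.Im (f (circ x))).

Definition fourierT (R : realType) (f : R[i] -> R[i]) (n : int) : R[i] :=
  intT (fun w => f w * w ^ (- n)).

(* H^u through boundary functions: the subspace of L^u of the circle on which all
   Fourier coefficients of negative index vanish (used for u >= 1). *)
Definition hardy (R : realType) (u : R) (f : R[i] -> R[i]) : Prop :=
  [/\ measT f, (normT u f < +oo)%E &
      forall n : int, n < 0 -> fourierT f n = 0].

Definition poisson (R : realType) (a w : R[i]) : R :=
  (1 - normc a ^+ 2) / normc (1 - a^* * w) ^+ 2.

(* The value at z in the disc of the analytic function with boundary function f. *)
Definition disc_ext (R : realType) (f : R[i] -> R[i]) (z : R[i]) : R[i] :=
  intT (fun w => (poisson z w)%:C * f w).

(* Outer functions: log |h| is integrable on the circle and, in the disc,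
   h(z) = c exp (int (w + z) / (w - z) log |h(w)| dm(w)) with |c| = 1.
   Since [ln 0 = 0], h <> 0 a.e. has to be required separately. *)
Definition outer (R : realType) (h : R[i] -> R[i]) : Prop :=
  [/\ {ae haarT R, forall x, h (circ x) != 0},
      (haarT R).-integrable [set: measurableTypeR R]
        (fun x => (ln (normc (h (circ x))))%:E) &
      exists2 c : R[i], normc c = 1 &
        forall z : R[i], normc z < 1 ->
          disc_ext h z =
          c * cexp (intT (fun w => (w + z) / (w - z) * (ln (normc (h w)))%:C))].

Definition texp (R : realType) (p : R) : R := 2 * p / (p - 2).

Definition calA (R : realType) (t : R) (K : nat) : set (R[i] -> R[i]) :=
  [set h | [/\ hardy t h, outer h &
    exists (a : 'I_K -> R[i]) (c : 'I_K -> R),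
      [/\ forall k, normc (a k) < 1, forall k, 0 <= c k, \sum_k c k = 1 &
          {ae haarT R, forall x,
             normc (h (circ x)) `^ t = \sum_k c k * poisson (a k) (circ x)}]]].

(* f has trigonometric degree at most D on the circle:
   f(w) = \sum_(-D <= n <= D) c_n w^n for |w| = 1. *)
Definition trig_deg_le (R : realType) (D : nat) (f : R[i] -> R[i]) : Prop :=
  exists c : 'I_(2 * D).+1 -> R[i], forall w : R[i], normc w = 1 ->
    f w = \sum_k c k * w ^ (k%:Z - D%:Z).

Section norming_constants.
Local Open Scope ereal_scope.
Context (R : realType) (t : R) (m : nat) (X : 'I_m -> {poly R[i]}).

Definition colnorm (h : R[i] -> R[i]) : \bar R :=
  (\sum_(j < m) normT 2 (fun w => ((X j).[w] * h w)%R) `^ t) `^ t^-1.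

Definition scrC (K : nat) : \bar R := ereal_sup [set colnorm h | h in calA t K].

Definition scrC_oo : \bar R :=
  ereal_sup [set colnorm h | h in [set h | hardy t h /\ normT t h <= 1]].

End norming_constants.

(* Main.v *)
Require Import Defs.
From mathcomp Require Import all_boot all_order all_algebra.
From mathcomp Require Import complex.
From mathcomp Require Import all_classical all_reals all_analysis.
From mathcomp Require Import measurable_realfun zify ring lra.
Import Order.TTheory GRing.Theory Num.Theory.
Import ComplexField.Normc.
Import numFieldNormedType.Exports.
Local Open Scope classical_set_scope.
Local Open Scope ring_scope.
Local Open Scope complex_scope.
(* Plain [ring_scope] reads this as the conjugation of an abstract closed field. *)
Local Notation "x ^*" := (@conjc _ x) : ring_scope.
Set Implicit Arguments.
Unset Strict Implicit.
Unset Printing Implicit Defensive.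

(** Write [t = 2 p / (p - 2)], [s = t / 2] and [q = p / 2], so that [1/s + 1/q = 1], and let
    [w_j = |X_j| ^ 2], [E_j(h)] the integral of [w_j |h| ^ 2].  The square of the quantity to be
    maximized is the [l^s] norm of the vector [E(h)], that is, the largest value of the integral
    of [W |h| ^ 2] when [W] runs through the combinations [\sum lam_j w_j] whose coefficients
    are nonnegative and have [l^q] norm one.  Each such [W] is a nonnegative trigonometric
    polynomial of degree at most [D], and for fixed [W] Hoelder's inequality shows that the
    maximum over the unit ball of [H^t] is at most the [L^q] norm of [W].

    It remains to come close to the [L^q] norm of [W] with a function of [A_K].  Take [K]
    Poisson kernels with centres [r zeta], [zeta] in a rotated set of [K]-th roots of unity, and
    masses proportional to [W(zeta) ^ q].  Three facts about equally spaced points suffice.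
    - The average of the [K] kernels lies below [(1 + r ^ K) / (1 - r ^ K)]
      ([sum_poisson_roots]).  Concavity of the power [1/s] then bounds the integral of
      [W |h| ^ 2] from below by the Poisson integrals of [W] at the centres.
    - The Poisson integral of [W] at [r zeta] is at least [r ^ (D + 1) W(zeta)]
      ([poisson_mean_trig_ge]), because it is given by a quadrature formula with nonnegative
      weights in which [zeta] is a node.
    - Averaged over all rotations, the mean of [W ^ q] over the roots of unity is its integral
      ([meanT_le_of_rotations]).
    So the squared norm loses at most the factor [kappa], which is
    [r ^ (D + 1) ((1 - r ^ K) / (1 + r ^ K)) ^ (1/q)] ([dual_bound]).  For
    [1 - r = 1 / sqrt (K (D + 1))] the loss is at most [3 sqrt ((D + 1) / K)], and for
    [D + 1 < K] this is below the bound claimed, because the exponent [(p - 2) / p] is at most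
    one and the logarithm at least one; for smaller [K] the claim is trivial.

    That the competitors belong to [A_K] requires an outer function with
    [|h| ^ t = \sum c_k P_{a_k}] ([calA_poisson_mixture]).  Up to the factors
    [|1 - a_k^* w| ^ 2] the mixture is the modulus of a polynomial without zeros on the circle,
    hence a constant times a product of factors [|1 - b w|] with [|b| < 1], and each factor is
    the modulus of an exponential of the disc algebra.  For exponentials of disc algebra
    functions the defining properties of [H^t] and of outer functions pass to the limit from
    polynomials. *)

(** * Modulus, conjugation and points of the circle *)

Section ComplexModulus.
Context {R : realType}.
Implicit Types z w a : R[i].

Lemma normc_ge0 z : 0 <= normc z.
Proof. by case: z => a b; rewrite sqrtr_ge0. Qed.

Lemma sqr_normc_ReIm z : normc z ^+ 2 = complex.Re z ^+ 2 + complex.Im z ^+ 2.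
Proof. by case: z => a b /=; rewrite sqr_sqrtr// addr_ge0 ?sqr_ge0. Qed.

Lemma normc_Num z : `|z| = (normc z)%:C.
Proof. by case: z. Qed.

Lemma normc_gt0 z : (0 < normc z) = (z != 0).
Proof.
rewrite lt_neqAle normc_ge0 andbT eq_sym; congr (~~ _).
by apply/eqP/eqP => [/eq0_normc//|->]; rewrite normc0.
Qed.

Lemma normc_real (x : R) : normc x%:C = `|x|.
Proof. by rewrite /= expr0n/= addr0 sqrtr_sqr. Qed.

Lemma normc_conj z : normc z^* = normc z.
Proof. by case: z => a b /=; rewrite sqrrN. Qed.

Lemma normcX z n : normc (z ^+ n) = normc z ^+ n.
Proof. by elim: n => [|n IH]; rewrite ?expr0 ?normc1// !exprS normcM IH. Qed.

Lemma normc_distC z w : normc (z - w) = normc (w - z).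
Proof. by rewrite -normcN opprB. Qed.

Lemma mulc_conj z : z * z^* = (normc z ^+ 2)%:C.
Proof.
rewrite sqr_normc_ReIm; case: z => a b; simpc.
by congr (_ +i* _); ring.
Qed.

Lemma le_Re_normc z : `|complex.Re z| <= normc z.
Proof.
rewrite -(@ler_pXn2r _ 2)// ?nnegrE ?normc_ge0//.
by rewrite sqr_normc_ReIm real_normK ?num_real// lerDl sqr_ge0.
Qed.

Lemma le_Im_normc z : `|complex.Im z| <= normc z.
Proof.
rewrite -(@ler_pXn2r _ 2)// ?nnegrE ?normc_ge0//.
by rewrite sqr_normc_ReIm real_normK ?num_real// lerDr sqr_ge0.
Qed.

Lemma normc_le_ReIm z : normc z <= `|complex.Re z| + `|complex.Im z|.
Proof.
rewrite -(@ler_pXn2r _ 2)// ?nnegrE ?normc_ge0// ?addr_ge0//.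
rewrite sqr_normc_ReIm sqrrD !real_normK ?num_real//.
by rewrite addrAC lerDl mulrn_wge0// mulr_ge0.
Qed.

Lemma normc_sum (I : Type) (r : seq I) (P : pred I) (F : I -> R[i]) :
  normc (\sum_(i <- r | P i) F i) <= \sum_(i <- r | P i) normc (F i).
Proof.
elim/big_ind2: _ => [|x1 x2 y1 y2 h1 h2|//]; first by rewrite normc0.
by rewrite (le_trans (le_normcD _ _))// lerD.
Qed.

Lemma lerB_normcB z w : normc z - normc w <= normc (z - w).
Proof. by rewrite lerBlDr (le_trans _ (le_normcD _ _))// subrK. Qed.

Lemma Re_add z w : complex.Re (z + w) = complex.Re z + complex.Re w.
Proof. by case: z; case: w. Qed.
Lemma Im_add z w : complex.Im (z + w) = complex.Im z + complex.Im w.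
Proof. by case: z; case: w. Qed.
Lemma Re_opp z : complex.Re (- z) = - complex.Re z.
Proof. by case: z. Qed.
Lemma Im_opp z : complex.Im (- z) = - complex.Im z.
Proof. by case: z. Qed.
Lemma Re_mul z w : complex.Re (z * w) =
  complex.Re z * complex.Re w - complex.Im z * complex.Im w.
Proof. by case: z; case: w. Qed.
Lemma Im_mul z w : complex.Im (z * w) =
  complex.Re z * complex.Im w + complex.Im z * complex.Re w.
Proof. by case: z; case: w. Qed.
Lemma Re_conjc z : complex.Re z^* = complex.Re z.
Proof. by case: z. Qed.
Lemma Im_conjc z : complex.Im z^* = - complex.Im z.
Proof. by case: z. Qed.
Lemma complex_eqP z w : complex.Re z = complex.Re w -> complex.Im z = complex.Im w -> z = w.
Proof. by case: z; case: w => a b c d /= -> ->. Qed.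

Lemma conjcM z w : (z * w)^* = z^* * w^*.
Proof. exact: rmorphM. Qed.

Lemma real_complexM (x y : R) : (x * y)%:C = x%:C * y%:C :> R[i].
Proof. exact: rmorphM. Qed.

Lemma real_complexB (x y : R) : (x - y)%:C = x%:C - y%:C :> R[i].
Proof. exact: rmorphB. Qed.

Lemma real_complexV (x : R) : (x^-1)%:C = (x%:C)^-1 :> R[i].
Proof. exact: fmorphV. Qed.

Lemma conjcX z n : (z ^+ n)^* = z^* ^+ n.
Proof. exact: rmorphXn. Qed.

Lemma normc_circ (x : R) : normc (circ x) = 1.
Proof. by rewrite /= cos2Dsin2 sqrtr1. Qed.

Lemma circD (x y : R) : circ (x + y) = circ x * circ y.
Proof. by rewrite /circ cosD sinD; simpc; congr (_ +i* _); rewrite addrC [sin x * _]mulrC. Qed.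

Lemma circ0 : circ (0 : R) = 1.
Proof. by rewrite /circ cos0 sin0. Qed.

Lemma circX (x : R) n : circ x ^+ n = circ (n%:R * x).
Proof.
elim: n => [|n IH]; first by rewrite expr0 mul0r circ0.
by rewrite exprS IH -circD -nat1r mulrDl mul1r.
Qed.

Lemma circN (x : R) : circ (- x) = (circ x)^*.
Proof. by rewrite /circ cosN sinN. Qed.

Lemma circ_periodic (x : R) : circ (x + 2 * pi) = circ x.
Proof.
by rewrite /circ mulrDl mul1r addrA cosDpi cosDpi sinDpi sinDpi !opprK.
Qed.

Lemma circ_onto w : normc w = 1 -> exists x : R, w = circ x.
Proof.
move=> w1; have := sqr_normc_ReIm w; rewrite w1 expr1n.
case: w {w1} => a b /= ab.
have a1 : -1 <= a <= 1.
  by rewrite -ler_norml -(@ler_pXn2r _ 2)// ?nnegrE// expr1n real_normK ?num_real// ab lerDl sqr_ge0.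
have [b0|b0] := leP 0 b.
- exists (acos a); rewrite /circ acosK// sin_acos//.
  by rewrite ab addrC addKr sqrtr_sqr ger0_norm.
- exists (- acos a); rewrite circN /circ acosK// sin_acos//; simpc.
  by rewrite ab addrC addKr sqrtr_sqr ltr0_norm// opprK.
Qed.

End ComplexModulus.

(** * Means of bounded functions over the circle *)

Section CircleMean.
Context {R : realType}.
Implicit Types u v : R[i] -> R.
Local Notation P := (haarT R).

(** The mean of a real function; like every notion below it sees only the values
    at the points of modulus one. *)
Definition meanT u : R := \int[P]_x u (circ x).

(** Bounded measurable functions: a class on which the mean is linear and which is
    closed under the products met below, so that integrability need not be tracked. *)
Definition bddT u : Prop :=
  measurable_fun [set: measurableTypeR R] (fun x : R => u (circ x)) /\
  exists M : R, forall w, normc w = 1 -> `|u w| <= M.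

Lemma bddT_integrable u : bddT u ->
  P.-integrable setT (EFin \o (fun x : R => u (circ x))).
Proof.
move=> [mu [M hM]]; apply: (@measurable_bounded_integrable _ _ _ P) => //.
  by apply: (@le_lt_trans _ _ 1%E); [exact: probability_le1|exact: ltry].
exists M; split; first exact: num_real.
by move=> N MN x _ /=; rewrite (le_trans (hM _ (normc_circ x)))// ltW.
Qed.

Lemma bddT_cst (c : R) : bddT (fun=> c).
Proof. by split; [exact: measurable_cst|exists `|c|]. Qed.

Lemma bddTD u v : bddT u -> bddT v -> bddT (fun w => u w + v w).
Proof.
move=> [mu [M hM]] [mv [N hN]]; split; first exact: measurable_funD.
by exists (M + N) => w w1; rewrite (le_trans (ler_normD _ _))// lerD ?hM ?hN.
Qed.

Lemma bddTM u v : bddT u -> bddT v -> bddT (fun w => u w * v w).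
Proof.
move=> [mu [M hM]] [mv [N hN]]; split; first exact: measurable_funM.
by exists (M * N) => w w1; rewrite normrM ler_pM ?hM ?hN.
Qed.

Lemma bddTZ (c : R) u : bddT u -> bddT (fun w => c * u w).
Proof. by move=> ?; apply: bddTM => //; exact: bddT_cst. Qed.

Lemma bddTN u : bddT u -> bddT (fun w => - u w).
Proof.
move=> /(bddTZ (-1)) [h [M hM]]; split.
  by apply: (eq_measurable_fun _ _ h) => x _; rewrite mulN1r.
by exists M => w /hM; rewrite mulN1r.
Qed.

Lemma bddTB u v : bddT u -> bddT v -> bddT (fun w => u w - v w).
Proof. by move=> ? ?; apply: bddTD => //; exact: bddTN. Qed.

Lemma eq_bddT u v : (forall w, normc w = 1 -> u w = v w) -> bddT u -> bddT v.
Proof.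
move=> uv [mu [M hM]]; split.
  by apply: (eq_measurable_fun _ _ mu) => x _; rewrite uv// normc_circ.
by exists M => w w1; rewrite -uv// hM.
Qed.

Lemma bddT_sum (I : Type) (r : seq I) (F : I -> R[i] -> R) :
  (forall i, bddT (F i)) -> bddT (fun w => \sum_(i <- r) F i w).
Proof.
move=> hF; elim: r => [|i r IH].
  by apply: (@eq_bddT (fun=> 0)) => [w _|]; [rewrite big_nil|exact: bddT_cst].
by apply: (@eq_bddT (fun w => F i w + \sum_(j <- r) F j w)) => [w _|];
  [rewrite big_cons|exact: bddTD].
Qed.

Lemma bddT_powR u (e : R) : bddT u -> 0 <= e -> bddT (fun w => `|u w| `^ e).
Proof.
move=> [mu [M hM]] e0; split.
  exact: (measurableT_comp (measurable_powR _) (measurableT_comp (@normr_measurable R setT) mu)).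
exists (M `^ e) => w w1; rewrite ger0_norm ?powR_ge0//.
by apply: ge0_ler_powR; rewrite ?nnegrE// ?hM// (le_trans _ (hM w w1)).
Qed.

Lemma eq_meanT u v : (forall w, normc w = 1 -> u w = v w) -> meanT u = meanT v.
Proof. by move=> uv; apply: eq_Rintegral => x _; rewrite uv// normc_circ. Qed.

Lemma meanT_cst (c : R) : meanT (fun=> c) = c.
Proof.
rewrite /meanT Rintegral_cst//.
have h : fine (P [set: measurableTypeR R]) = 1 by rewrite (probability_setT P).
by have -> : fine (P setT) = 1 by []; rewrite mulr1.
Qed.

Lemma meanTD u v : bddT u -> bddT v -> meanT (fun w => u w + v w) = meanT u + meanT v.
Proof. by move=> hu hv; rewrite /meanT RintegralD//; exact: bddT_integrable. Qed.

Lemma meanTZ (c : R) u : bddT u -> meanT (fun w => c * u w) = c * meanT u.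
Proof. by move=> hu; rewrite /meanT RintegralZl//; exact: bddT_integrable. Qed.

Lemma meanTN u : bddT u -> meanT (fun w => - u w) = - meanT u.
Proof. by move=> hu; rewrite -mulN1r -meanTZ//; apply: eq_meanT => w _; rewrite mulN1r. Qed.

Lemma meanTB u v : bddT u -> bddT v -> meanT (fun w => u w - v w) = meanT u - meanT v.
Proof. by move=> hu hv; rewrite -meanTN// -meanTD//; exact: bddTN. Qed.

Lemma meanT_sum (I : Type) (r : seq I) (F : I -> R[i] -> R) :
  (forall i, bddT (F i)) ->
  meanT (fun w => \sum_(i <- r) F i w) = \sum_(i <- r) meanT (F i).
Proof.
move=> hF; elim: r => [|i r IH].
  by rewrite big_nil -[RHS](meanT_cst 0); apply: eq_meanT => w _; rewrite big_nil.
rewrite big_cons -IH -meanTD//; last exact: bddT_sum.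
by apply: eq_meanT => w _; rewrite big_cons.
Qed.

Lemma le_meanT u v : bddT u -> bddT v ->
  (forall w, normc w = 1 -> u w <= v w) -> meanT u <= meanT v.
Proof.
move=> hu hv uv; apply: le_Rintegral => //; [exact: bddT_integrable..|].
by move=> x _; rewrite uv// normc_circ.
Qed.

Lemma meanT_ge0 u : (forall w, normc w = 1 -> 0 <= u w) -> 0 <= meanT u.
Proof. by move=> u0; apply: Rintegral_ge0 => x _; rewrite u0// normc_circ. Qed.

Lemma normr_meanT u M : bddT u -> (forall w, normc w = 1 -> `|u w| <= M) ->
  `|meanT u| <= M.
Proof.
move=> hu hM; rewrite ler_norml; apply/andP; split.
  rewrite -(meanT_cst (- M)); apply: le_meanT => //; first exact: bddT_cst.
  by move=> w w1; have := hM w w1; rewrite ler_norml => /andP[].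
rewrite -(meanT_cst M); apply: le_meanT => //; first exact: bddT_cst.
by move=> w w1; have := hM w w1; rewrite ler_norml => /andP[].
Qed.

End CircleMean.

(** * Rotation invariance of the mean *)

Section Rotation.
Context {R : realType}.
Local Notation mu := (@lebesgue_measure R).

Lemma ge0_integral_shift (a b c : R) (f : R -> \bar R) :
  measurable_fun setT f -> (forall x, (0 <= f x)%E) ->
  (\int[mu]_(x in `[a, b]) f (x + c)%R = \int[mu]_(x in `[(a + c)%R, (b + c)%R]) f x)%E.
Proof.
move=> mf f0.
pose sh := (fun x : measurableTypeR R => (x + c : measurableTypeR R)).
have msh : measurable_fun setT sh by exact: measurable_funD.
have preim (i j : R) : sh @^-1` `]i, j]%classic = `](i - c), (j - c)]%classic.
  by apply/seteqP; split => x /=; rewrite !in_itv/= /sh ltrBlDr lerBrDr.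
have -> : `[a, b]%classic = sh @^-1` `[a + c, b + c]%classic.
  by apply/seteqP; split => x /=; rewrite !in_itv/= /sh !lerD2r.
transitivity (\int[pushforward mu sh]_(x in `[(a + c)%R, (b + c)%R]) f x)%E.
  rewrite ge0_integral_pushforward//; exact: measurable_funS mf.
apply: eq_measure_integral => A mA _; apply/esym.
apply: lebesgue_measure_unique => //= _ [[i j]] _ <-.
rewrite /pushforward preim !lebesgue_measure_itv/= !lte_fin ltrD2r.
by case: ifP => // _; rewrite -!EFinB; congr EFin; ring.
Qed.

Lemma ge0_integral_itv_split (a b c : R) (f : R -> \bar R) : a <= b -> b <= c ->
  measurable_fun setT f -> (forall x, (0 <= f x)%E) ->
  (\int[mu]_(x in `[a, c]) f x =
   \int[mu]_(x in `[a, b]) f x + \int[mu]_(x in `[b, c]) f x)%E.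
Proof.
move=> ab bc mf f0.
have -> : `[a, c]%classic = `[a, b[%classic `|` `[b, c]%classic.
  by rewrite -itv_bndbnd_setU ?bnd_simp.
rewrite ge0_integral_setU//=; first last.
- apply/disj_setPS => y [/=]; rewrite !in_itv/= => /andP[_ yb] /andP[].
  by rewrite leNgt yb.
- exact: measurable_funS mf.
by rewrite integral_itv_bndo_bndc//; exact: measurable_funS mf.
Qed.

(** Shift the window of integration, split it at the period, and shift the part
    that sticks out back by one period. *)
Lemma ge0_integral_period (T tau : R) (f : R -> \bar R) : 0 <= tau <= T ->
  measurable_fun setT f -> (forall x, (0 <= f x)%E) ->
  (forall x, f (x + T) = f x) ->
  (\int[mu]_(x in `[0%R, T]) f (x + tau)%R = \int[mu]_(x in `[0%R, T]) f x)%E.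
Proof.
move=> /andP[t0 tT] mf f0 fT.
rewrite ge0_integral_shift// add0r (@ge0_integral_itv_split tau T)//; last first.
  by rewrite lerDl.
rewrite (@ge0_integral_itv_split 0 tau T)// addeC; congr (_ + _)%E.
rewrite -{1}[T]add0r [(T + _)%R]addrC -ge0_integral_shift//.
by apply: eq_integral => x _; rewrite fT.
Qed.

Lemma bddT_rot (u : R[i] -> R) (tau : R) : bddT u -> bddT (fun w => u (w * circ tau)).
Proof.
move=> [mu_ [M hM]]; split; last first.
  by exists M => w w1; apply: hM; rewrite normcM w1 normc_circ mulr1.
have msh : measurable_fun setT (fun x : measurableTypeR R => (x + tau : measurableTypeR R)).
  exact: measurable_funD.
by apply: (eq_measurable_fun _ _ (measurableT_comp mu_ msh)) => x _ /=; rewrite circD.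
Qed.

(** Adding a bound of [u] reduces to a nonnegative function, for which the
    statement is the invariance of the integral of a periodic function over a period. *)
Lemma meanT_rot (u : R[i] -> R) (tau : R) : 0 <= tau <= 2 * pi ->
  bddT u -> meanT (fun w => u (w * circ tau)) = meanT u.
Proof.
move=> tp hu; have [mu_ [M hM]] := hu; have hut := bddT_rot tau hu.
have h0 w : normc w = 1 -> 0 <= u w + M.
  by move=> w1; have := hM w w1; rewrite ler_norml => /andP[+ _]; rewrite lerNl; lra.
suff : meanT (fun w => u (w * circ tau) + M) = meanT (fun w => u w + M).
  by rewrite !meanTD//; try exact: bddT_cst; move/addIr.
rewrite /meanT /Rintegral; congr fine.
rewrite !integral_uniform//; first last.
- by move=> x; rewrite lee_fin h0// normcM !normc_circ mulr1.
- by apply/measurable_EFinP; apply: measurable_funD => //; case: hut.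
- by move=> x; rewrite lee_fin h0// normc_circ.
- by apply/measurable_EFinP; apply: measurable_funD.
congr (_ * _)%E.
rewrite -(@ge0_integral_period (2 * pi) tau (fun x => (u (circ x) + M)%:E))//.
- by apply: eq_integral => x _; rewrite circD.
- by apply/measurable_EFinP; apply: measurable_funD.
- by move=> x; rewrite lee_fin h0// normc_circ.
- by move=> x; rewrite circ_periodic.
Qed.

End Rotation.

(** * Complex-valued means and the orthogonality of powers *)

Section CircleIntegral.
Context {R : realType}.
Implicit Types (f g : R[i] -> R[i]) (z w c : R[i]).

(** The approximations at precision [1/(n+1)] converge pointwise, which gives
    measurability. *)
Lemma bddT_uniform_limit (u : R[i] -> R) :
  (forall e : R, 0 < e -> exists2 v, bddT v &
     forall w, normc w = 1 -> `|u w - v w| <= e) -> bddT u.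
Proof.
move=> h.
have {h}/choice[v hv] : forall n : nat, exists v : R[i] -> R, bddT v /\
    forall w, normc w = 1 -> `|u w - v w| <= n.+1%:R^-1.
  by move=> n; have [|v ? ?] := h n.+1%:R^-1; [rewrite invr_gt0|exists v].
split.
  apply: (@measurable_fun_cvg _ _ _ _ (fun n x => v n (circ x))).
    by move=> n; have [[]] := hv n.
  move=> x _; apply/cvgrPdist_le => e e0.
  near=> n; have [_ /(_ _ (normc_circ x))] := hv n.
  move=> /le_trans; apply; near: n.
  by apply: filterS (near_infty_natSinv_lt (PosNum e0)) => n /ltW.
have [[_ [M hM]] h1] := hv 0%N.
exists (1 + M) => w w1; rewrite -[u w](subrK (v 0%N w)).
by rewrite (le_trans (ler_normD _ _))// lerD ?hM// (le_trans (h1 _ w1))// invr1.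
Unshelve. all: by end_near. Qed.

Definition bddC f : Prop :=
  bddT (fun w => complex.Re (f w)) /\ bddT (fun w => complex.Im (f w)).

Lemma bddC_measT f : bddC f -> measT f.
Proof. by move=> [[? _] [? _]]. Qed.

Lemma eq_bddC f g : (forall w, normc w = 1 -> f w = g w) -> bddC f -> bddC g.
Proof.
by move=> fg [h1 h2]; split; [apply: eq_bddT h1|apply: eq_bddT h2] => w w1; rewrite fg.
Qed.

Lemma bddC_bounded f : bddC f -> exists2 M : R, 0 <= M & forall w, normc w = 1 -> normc (f w) <= M.
Proof.
move=> [[_ [M hM]] [_ [N hN]]]; exists (M + N).
  by rewrite addr_ge0//; [have := hM 1 (normc1 R)|have := hN 1 (normc1 R)]; apply: le_trans.
by move=> w w1; rewrite (le_trans (normc_le_ReIm _))// lerD ?hM ?hN.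
Qed.

Lemma measT_normc (h : R[i] -> R[i]) : measT h ->
  measurable_fun [set: measurableTypeR R] (fun x : R => normc (h (circ x))).
Proof.
move=> [m1 m2].
have m : measurable_fun [set: measurableTypeR R]
   (fun x : R => Num.sqrt (complex.Re (h (circ x)) ^+ 2 + complex.Im (h (circ x)) ^+ 2)).
  apply: (measurableT_comp (continuous_measurable_fun (@sqrt_continuous R))).
  by apply: measurable_funD; exact: measurable_funX.
by apply: (eq_measurable_fun _ _ m) => x _; case: (h _).
Qed.

Lemma bddC_normc f : bddC f -> bddT (fun w => normc (f w)).
Proof.
move=> hf; have [M _ hM] := bddC_bounded hf; split; first exact: (measT_normc (bddC_measT hf)).
by exists M => w w1; rewrite ger0_norm ?normc_ge0// hM.
Qed.

Lemma bddC_real (u : R[i] -> R) : bddT u -> bddC (fun w => (u w)%:C).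
Proof. by move=> h; split => //; exact: bddT_cst. Qed.

Lemma bddC_cst c : bddC (fun=> c).
Proof. by split; exact: bddT_cst. Qed.

Lemma bddCD f g : bddC f -> bddC g -> bddC (fun w => f w + g w).
Proof.
move=> [f1 f2] [g1 g2]; split.
  by apply: eq_bddT (bddTD f1 g1) => w _; rewrite Re_add.
by apply: eq_bddT (bddTD f2 g2) => w _; rewrite Im_add.
Qed.

Lemma bddCM f g : bddC f -> bddC g -> bddC (fun w => f w * g w).
Proof.
move=> [f1 f2] [g1 g2]; split.
  by apply: eq_bddT (bddTB (bddTM f1 g1) (bddTM f2 g2)) => w _; rewrite Re_mul.
by apply: eq_bddT (bddTD (bddTM f1 g2) (bddTM f2 g1)) => w _; rewrite Im_mul.
Qed.

Lemma bddCJ f : bddC f -> bddC (fun w => (f w)^*).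
Proof.
move=> [f1 f2]; split; first by apply: eq_bddT f1 => w _; rewrite Re_conjc.
by apply: eq_bddT (bddTN f2) => w _; rewrite Im_conjc.
Qed.

Lemma bddC_id : bddC id.
Proof.
split.
  split; first exact: (continuous_measurable_fun (@continuous_cos R)).
  by exists 1 => w <-; exact: le_Re_normc.
split; first exact: (continuous_measurable_fun (@continuous_sin R)).
by exists 1 => w <-; exact: le_Im_normc.
Qed.

Lemma bddCX f n : bddC f -> bddC (fun w => f w ^+ n).
Proof.
move=> hf; elim: n => [|n IH].
  by apply: eq_bddC (bddC_cst 1) => w _; rewrite expr0.
by apply: eq_bddC (bddCM hf IH) => w _; rewrite exprS.
Qed.

Lemma bddC_sum (I : Type) (r : seq I) (F : I -> R[i] -> R[i]) :
  (forall i, bddC (F i)) -> bddC (fun w => \sum_(i <- r) F i w).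
Proof.
move=> hF; elim: r => [|i r IH].
  by apply: (@eq_bddC (fun=> 0)) => [w _|]; [rewrite big_nil|exact: bddC_cst].
by apply: (@eq_bddC (fun w => F i w + \sum_(j <- r) F j w)) => [w _|];
  [rewrite big_cons|exact: bddCD].
Qed.

Lemma bddC_poly (p : {poly R[i]}) : bddC (fun w => p.[w]).
Proof.
elim/poly_ind: p => [|p c IH].
  by apply: eq_bddC (bddC_cst 0) => w _; rewrite horner0.
apply: eq_bddC (bddCD (bddCM IH bddC_id) (bddC_cst c)) => w _.
by rewrite hornerMXaddC.
Qed.

Lemma bddC_uniform_limit f :
  (forall e : R, 0 < e -> exists2 g, bddC g &
     forall w, normc w = 1 -> normc (f w - g w) <= e) -> bddC f.
Proof.
move=> h; split; apply: bddT_uniform_limit => e /h[g [g1 g2] fg].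
  exists (fun w => complex.Re (g w)) => // w w1.
  by rewrite -Re_opp -Re_add (le_trans (le_Re_normc _))// fg.
exists (fun w => complex.Im (g w)) => // w w1.
by rewrite -Im_opp -Im_add (le_trans (le_Im_normc _))// fg.
Qed.

Lemma Re_intT f : complex.Re (intT f) = meanT (fun w => complex.Re (f w)).
Proof. by []. Qed.
Lemma Im_intT f : complex.Im (intT f) = meanT (fun w => complex.Im (f w)).
Proof. by []. Qed.

Lemma eq_intT f g : (forall w, normc w = 1 -> f w = g w) -> intT f = intT g.
Proof.
move=> fg; congr (_ +i* _).
  by apply: (@eq_meanT _ (fun w => complex.Re (f w)) (fun w => complex.Re (g w))) => w /fg ->.
by apply: (@eq_meanT _ (fun w => complex.Im (f w)) (fun w => complex.Im (g w))) => w /fg ->.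
Qed.

Lemma intT_cst c : intT (fun=> c) = c.
Proof. by rewrite [RHS](_ : _ = complex.Re c +i* complex.Im c); [congr (_ +i* _); exact: meanT_cst|case: c]. Qed.

Lemma intTD f g : bddC f -> bddC g -> intT (fun w => f w + g w) = intT f + intT g.
Proof.
move=> [f1 f2] [g1 g2]; apply: complex_eqP; rewrite ?Re_add ?Im_add ?Re_intT ?Im_intT -meanTD//.
  by apply: eq_meanT => w _; rewrite Re_add.
by apply: eq_meanT => w _; rewrite Im_add.
Qed.

Lemma intTZ c f : bddC f -> intT (fun w => c * f w) = c * intT f.
Proof.
move=> [f1 f2]; apply: complex_eqP; rewrite ?Re_mul ?Im_mul ?Re_intT ?Im_intT -!meanTZ//.
  by rewrite -meanTB; [apply: eq_meanT => w _; rewrite Re_mul|exact: bddTZ..].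
by rewrite -meanTD; [apply: eq_meanT => w _; rewrite Im_mul|exact: bddTZ..].
Qed.

Lemma intTJ f : bddC f -> intT (fun w => (f w)^*) = (intT f)^*.
Proof.
move=> [f1 f2]; apply: complex_eqP; rewrite ?Re_conjc ?Im_conjc ?Re_intT ?Im_intT.
  by apply: eq_meanT => w _; rewrite Re_conjc.
by rewrite -meanTN//; apply: eq_meanT => w _; rewrite Im_conjc.
Qed.

Lemma intTB f g : bddC f -> bddC g -> intT (fun w => f w - g w) = intT f - intT g.
Proof.
move=> hf hg; rewrite -mulN1r -intTZ// -intTD//.
  by apply: eq_intT => w _; rewrite mulN1r.
by apply: bddCM => //; exact: bddC_cst.
Qed.

Lemma intT_sum (I : Type) (r : seq I) (F : I -> R[i] -> R[i]) :
  (forall i, bddC (F i)) ->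
  intT (fun w => \sum_(i <- r) F i w) = \sum_(i <- r) intT (F i).
Proof.
move=> hF; elim: r => [|i r IH].
  by rewrite big_nil -[RHS](intT_cst 0); apply: eq_intT => w _; rewrite big_nil.
rewrite big_cons -IH -intTD//; last exact: bddC_sum.
by apply: eq_intT => w _; rewrite big_cons.
Qed.

Lemma intT_real (u : R[i] -> R) : intT (fun w => (u w)%:C) = (meanT u)%:C.
Proof. by congr (_ +i* _); exact: (meanT_cst 0). Qed.

(** The factor two comes from estimating the real and the imaginary part separately. *)
Lemma normc_intT f M : bddC f -> (forall w, normc w = 1 -> normc (f w) <= M) ->
  normc (intT f) <= M + M.
Proof.
move=> [f1 f2] hM; rewrite (le_trans (normc_le_ReIm _))// lerD//.
  by rewrite Re_intT; apply: normr_meanT => // w w1; rewrite (le_trans (le_Re_normc _))// hM.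
by rewrite Im_intT; apply: normr_meanT => // w w1; rewrite (le_trans (le_Im_normc _))// hM.
Qed.

Lemma intT_rot f (tau : R) : 0 <= tau <= 2 * pi -> bddC f ->
  intT (fun w => f (w * circ tau)) = intT f.
Proof.
move=> t0 [f1 f2]; congr (_ +i* _).
  exact: (@meanT_rot _ (fun w => complex.Re (f w))).
exact: (@meanT_rot _ (fun w => complex.Im (f w))).
Qed.

(** Rotating by the angle [pi / n] multiplies the [n]-th power by [-1] and leaves
    its mean unchanged. *)
Lemma intTXn n : intT (fun w : R[i] => w ^+ n) = (n == 0%N)%:R.
Proof.
case: n => [|n]; first by rewrite -[RHS](intT_cst 1); apply: eq_intT => w _; rewrite expr0.
have n0 : n.+1%:R != 0 :> R by rewrite pnatr_eq0.
have tp : 0 <= (pi / n.+1%:R : R) <= 2 * pi.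
  have := pi_gt0 R; have : (1 : R) <= n.+1%:R by rewrite ler1n.
  move=> n1 p0; apply/andP; split; first by rewrite divr_ge0// ltW.
  rewrite ler_pdivrMr; last by lra.
  nra.
have e : circ (n.+1%:R * (pi / n.+1%:R)) = -1 :> R[i].
  by rewrite mulrC divfK// /circ cospi sinpi; apply: complex_eqP; rewrite ?Re_opp ?Im_opp //= oppr0.
have h := intT_rot tp (bddCX n.+1 bddC_id).
have {}h : - intT (fun w : R[i] => w ^+ n.+1) = intT (fun w : R[i] => w ^+ n.+1).
  rewrite -[RHS]h -mulN1r -intTZ; last exact: bddCX bddC_id.
  by apply: eq_intT => w _; rewrite exprMn circX e mulrC.
by move: h; case: (intT _) => a b [ha hb]; apply: complex_eqP => /=; lra.
Qed.

End CircleIntegral.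

(** * The Cauchy, Poisson and Schwarz kernels on polynomials *)

Section Kernels.
Context {R : realType}.
Implicit Types (f g : R[i] -> R[i]) (z w c u : R[i]) (p : {poly R[i]}).

Lemma exists_expr_lt (r e : R) : 0 <= r -> r < 1 -> 0 < e -> exists n, r ^+ n < e.
Proof.
move=> r0 r1 e0.
have cv : (fun n => r ^+ n) @ \oo --> (0 : R) by apply: cvg_expr; rewrite ger0_norm.
have [N _ hN] := (cvgrPdist_lt _ _).1 cv _ e0.
exists N; have := hN N (leqnn N).
by rewrite /= sub0r normrN ger0_norm// exprn_ge0.
Qed.

Lemma normc_1B_ge u : 1 - normc u <= normc (1 - u).
Proof. by rewrite -{1}(normc1 R) lerB_normcB. Qed.

Lemma oneB_neq0 u : normc u < 1 -> 1 - u != 0.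
Proof.
by move=> u1; rewrite -normc_gt0 (lt_le_trans _ (normc_1B_ge u))// subr_gt0.
Qed.

(** The remainder of the geometric series, in the form in which both the kernel
    and the logarithm use it. *)
Lemma sub_geometric u n : normc u < 1 ->
  (1 - u)^-1 - \sum_(k < n) u ^+ k = u ^+ n * (1 - u)^-1.
Proof.
move=> u1; have u0 := oneB_neq0 u1; apply: (mulfI u0).
rewrite mulrBr divff// mulrCA divff// mulr1.
have := subrX1 u n; rewrite -opprB -(opprB 1 u) mulNr => /oppr_inj <-.
by rewrite opprB addrC subrK.
Qed.

(** On the circle this is [w / (w - z)], since the conjugate of [w] is its inverse;
    written this way it is a geometric series in the conjugate of [w]. *)
Definition cauchyk z w : R[i] := (1 - z * w^*)^-1.

Lemma normc_zJ z w : normc w = 1 -> normc (z * w^*) = normc z.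
Proof. by move=> w1; rewrite normcM normc_conj w1 mulr1. Qed.

Lemma conj_inv w : normc w = 1 -> w^* * w = 1.
Proof. by move=> w1; rewrite mulrC mulc_conj w1 expr1n. Qed.

Lemma normc_cauchyk z w : normc z < 1 -> normc w = 1 ->
  normc (cauchyk z w) <= (1 - normc z)^-1.
Proof.
move=> z1 w1; rewrite /cauchyk normcV lef_pV2 ?posrE ?subr_gt0//.
  by rewrite (le_trans _ (normc_1B_ge _))// normc_zJ.
by rewrite normc_gt0 oneB_neq0// normc_zJ.
Qed.

Lemma bddC_cauchyk z : normc z < 1 -> bddC (cauchyk z).
Proof.
move=> z1; apply: bddC_uniform_limit => e e0.
have [n hn] : exists n, normc z ^+ n < e * (1 - normc z).
  by apply: exists_expr_lt; rewrite ?normc_ge0// mulr_gt0// subr_gt0.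
exists (fun w => \sum_(k < n) (z * w^*) ^+ k).
  apply: bddC_sum => k; apply: bddCX; apply: bddCM; first exact: bddC_cst.
  by apply: bddCJ; exact: bddC_id.
move=> w w1; rewrite sub_geometric ?normc_zJ// normcM normcX normc_zJ//.
rewrite (le_trans (ler_wpM2l _ (normc_cauchyk z1 w1))) ?exprn_ge0 ?normc_ge0//.
by rewrite ler_pdivrMr ?subr_gt0// ltW.
Qed.

(** The equation satisfied by a geometric series. It yields recurrences for all
    the moments of the kernel, so the series is never integrated term by term. *)
Lemma cauchyk_rec z w : normc z < 1 -> normc w = 1 ->
  cauchyk z w = 1 + z * w^* * cauchyk z w.
Proof.
move=> z1 w1; have h : 1 - z * w^* != 0 by rewrite oneB_neq0// normc_zJ.
by apply: (mulfI h); rewrite /cauchyk mulrDr mulrCA divff//; ring.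
Qed.

Lemma bddCXJ n : bddC (fun w : R[i] => (w^*) ^+ n).
Proof. by apply: bddCX; apply: bddCJ; exact: bddC_id. Qed.

Lemma intTXJ n : intT (fun w : R[i] => (w^*) ^+ n) = (n == 0%N)%:R.
Proof.
rewrite -[RHS]conjc_nat -intTXn -intTJ; last exact: bddCX bddC_id.
by apply: eq_intT => w _; rewrite rmorphXn.
Qed.

(** By the recurrence these moments satisfy [G m = z * G (m + 1)]; being bounded,
    they vanish. *)
Lemma intT_cauchyk_negS z n : normc z < 1 ->
  intT (fun w => cauchyk z w * (w^*) ^+ n.+1) = 0.
Proof.
move=> z1; have bk := bddC_cauchyk z1.
pose G m := intT (fun w => cauchyk z w * (w^*) ^+ m).
have Gr m : G m.+1 = z * G m.+2.
  rewrite /G -intTZ; last by apply: bddCM => //; exact: bddCXJ.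
  rewrite -[RHS]add0r -(_ : intT (fun w : R[i] => (w^*) ^+ m.+1) = 0); last by rewrite intTXJ.
  rewrite -intTD; first last.
  - by apply: bddCM; [exact: bddC_cst|apply: bddCM => //; exact: bddCXJ].
  - exact: bddCXJ.
  apply: eq_intT => w w1; rewrite {1}cauchyk_rec// [_ ^+ m.+2]exprS; ring.
have Gm m : normc (G n.+1) <= normc z ^+ m * ((1 - normc z)^-1 + (1 - normc z)^-1).
  have -> : G n.+1 = z ^+ m * G (n + m).+1.
    elim: m => [|m ->]; first by rewrite expr0 mul1r addn0.
    by rewrite Gr addnS exprSr mulrA.
  rewrite normcM normcX ler_wpM2l ?exprn_ge0 ?normc_ge0// normc_intT//.
    by apply: bddCM => //; exact: bddCXJ.
  move=> w w1; rewrite normcM normcX normc_conj w1 expr1n mulr1.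
  exact: normc_cauchyk.
apply: eq0_normc; apply/eqP; rewrite eq_le normc_ge0 andbT leNgt; apply/negP => g0.
have B0 : 0 < (1 - normc z)^-1 + (1 - normc z)^-1.
  by rewrite addr_gt0// invr_gt0 subr_gt0.
have [m] : exists m, normc z ^+ m < normc (G n.+1) / ((1 - normc z)^-1 + (1 - normc z)^-1).
  by apply: exists_expr_lt; rewrite ?normc_ge0// divr_gt0.
by rewrite ltr_pdivlMr// ltNge Gm.
Qed.

Lemma intT_cauchykJX z n : normc z < 1 ->
  intT (fun w => cauchyk z w * (w^*) ^+ n) = (n == 0%N)%:R.
Proof.
move=> z1; case: n => [|n]; last exact: intT_cauchyk_negS.
have bk := bddC_cauchyk z1.
have -> : intT (fun w => cauchyk z w * w^* ^+ 0) =
   intT (fun w => 1 + z * (cauchyk z w * w^* ^+ 1)).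
  apply: eq_intT => w w1; rewrite expr0 expr1 mulr1 {1}cauchyk_rec//; ring.
have bJ : bddC (fun w => cauchyk z w * w^* ^+ 1) by apply: bddCM => //; exact: bddCXJ.
rewrite intTD; [|exact: bddC_cst|by apply: bddCM => //; exact: bddC_cst].
by rewrite intT_cst intTZ// intT_cauchyk_negS// mulr0 addr0.
Qed.

Lemma intT_cauchykX z n : normc z < 1 ->
  intT (fun w => cauchyk z w * w ^+ n) = z ^+ n.
Proof.
move=> z1; have bk := bddC_cauchyk z1.
elim: n => [|n IH].
  by rewrite expr0 -[RHS](intT_cauchykJX 0 z1); apply: eq_intT => w w1; rewrite !expr0.
have bX : bddC (fun w => cauchyk z w * w ^+ n) by apply: bddCM => //; exact: bddCX bddC_id.
have -> : intT (fun w => cauchyk z w * w ^+ n.+1) =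
   intT (fun w => w ^+ n.+1 + z * (cauchyk z w * w ^+ n)).
  apply: eq_intT => w w1; rewrite {1}cauchyk_rec// exprS.
  transitivity (w * w ^+ n + z * (cauchyk z w * (w^* * w) * w ^+ n)); first ring.
  by rewrite conj_inv// mulr1.
rewrite intTD; first last.
- by apply: bddCM => //; exact: bddC_cst.
- exact: bddCX bddC_id.
by rewrite intTXn add0r intTZ// IH exprS.
Qed.

Lemma poissonE z w : normc z < 1 -> normc w = 1 ->
  (poisson z w)%:C = cauchyk z w + (cauchyk z w)^* - 1.
Proof.
move=> z1 w1; have h : 1 - z * w^* != 0 by rewrite oneB_neq0// normc_zJ.
have hJ : (1 - z * w^*)^* = 1 - z^* * w.
  by rewrite rmorphB rmorph1 rmorphM/= conjcK.
have h' : 1 - z^* * w != 0 by rewrite -hJ conjc_eq0.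
have e : (normc (1 - z^* * w) ^+ 2)%:C = (1 - z^* * w) * (1 - z * w^*).
  rewrite -mulc_conj; congr (_ * _); rewrite -hJ.
  by rewrite conjcK.
rewrite /poisson rmorphM fmorphV rmorphB rmorph1/= e -mulc_conj.
rewrite /cauchyk conjc_inv hJ.
apply: (mulfI (mulf_neq0 h h')); rewrite mulrCA.
have -> : (1 - z * w^*) * (1 - z^* * w) / ((1 - z^* * w) * (1 - z * w^*)) = 1.
  by rewrite mulrC [_ * (1 - z * _)]mulrC mulVf// mulf_neq0.
rewrite mulr1 mulrBr mulrDr mulrAC divff// mul1r -mulrA divff// mulr1.
have -> : z * z^* = z * z^* * (w^* * w) by rewrite conj_inv// mulr1.
ring.
Qed.

Lemma poisson_ge0 z w : normc z < 1 -> 0 <= poisson z w.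
Proof.
move=> z1; rewrite divr_ge0 ?sqr_ge0// subr_ge0 exprn_ile1 ?normc_ge0// ltW//.
Qed.

Lemma poisson_gt0 z w : normc z < 1 -> normc w = 1 -> 0 < poisson z w.
Proof.
move=> z1 w1; rewrite divr_gt0//.
  by rewrite subr_gt0 exprn_ilt1 ?normc_ge0.
by rewrite exprn_gt0// normc_gt0 oneB_neq0// normcM normc_conj w1 mulr1.
Qed.

Lemma bddT_poisson z : normc z < 1 -> bddT (poisson z).
Proof.
move=> z1; have bk := bddC_cauchyk z1.
have [h _] := bddCD (bddCD bk (bddCJ bk)) (bddC_cst (-1)).
by apply: eq_bddT h => w w1; rewrite -poissonE.
Qed.

(** The kernel in the definition of outer functions is an affine function of the
    Cauchy kernel. *)
Lemma schwarz_kernelE z w : normc z < 1 -> normc w = 1 ->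
  (w + z) / (w - z) = 2%:R * cauchyk z w - 1.
Proof.
move=> z1 w1; have h : 1 - z * w^* != 0 by rewrite oneB_neq0// normc_zJ.
have w0 : w != 0 by rewrite -normc_gt0 w1.
have e : w - z = w * (1 - z * w^*).
  by rewrite mulrBr mulr1 mulrCA mulc_conj w1 expr1n mulr1.
have wz : w - z != 0 by rewrite e mulf_neq0.
have k : (w - z) * cauchyk z w = w by rewrite e /cauchyk mulfK.
apply: (mulfI wz); rewrite mulrC mulfVK//.
by rewrite mulrBr mulr1 mulrCA k; ring.
Qed.

Lemma intT_mul_poly f p : bddC f ->
  intT (fun w => f w * p.[w]) = \sum_(i < size p) p`_i * intT (fun w => f w * w ^+ i).
Proof.
move=> bf.
have b i : bddC (fun w => f w * w ^+ i) by apply: bddCM => //; exact: bddCX bddC_id.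
transitivity (\sum_(i < size p) intT (fun w => p`_i * (f w * w ^+ i))); last first.
  by apply: eq_bigr => i _; rewrite intTZ.
rewrite -intT_sum; last by move=> i; apply: bddCM => //; exact: bddC_cst.
apply: eq_intT => w _; rewrite horner_coef mulr_sumr.
by apply: eq_bigr => i _; ring.
Qed.

Lemma intT_cauchyk_poly z p : normc z < 1 ->
  intT (fun w => cauchyk z w * p.[w]) = p.[z].
Proof.
move=> z1; rewrite intT_mul_poly; last exact: bddC_cauchyk.
by rewrite horner_coef; apply: eq_bigr => i _; rewrite intT_cauchykX.
Qed.

Lemma sum_coef_delta0 p : \sum_(i < size p) p`_i * (i == 0%N :> nat)%:R = p.[0].
Proof.
rewrite horner_coef; apply: eq_bigr => i _; congr (_ * _).
by case: i => -[|i] _ /=; rewrite ?expr0// exprS mul0r.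
Qed.

Lemma intT_poly p : intT (fun w => p.[w]) = p.[0].
Proof.
rewrite -sum_coef_delta0.
transitivity (intT (fun w => 1 * p.[w])); first by apply: eq_intT => w _; rewrite mul1r.
rewrite intT_mul_poly; last exact: bddC_cst.
apply: eq_bigr => i _; congr (_ * _); rewrite -intTXn.
by apply: eq_intT => w _; rewrite mul1r.
Qed.

Lemma intT_cauchykJ_poly z p : normc z < 1 ->
  intT (fun w => (cauchyk z w)^* * p.[w]) = p.[0].
Proof.
move=> z1; rewrite intT_mul_poly; last by apply: bddCJ; exact: bddC_cauchyk.
rewrite -sum_coef_delta0; apply: eq_bigr => i _; congr (_ * _).
rewrite -[RHS]conjc_nat -(intT_cauchykJX i z1) -intTJ; last first.
  by apply: bddCM; [exact: bddC_cauchyk|exact: bddCXJ].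
by apply: eq_intT => w _; rewrite rmorphM/= rmorphXn/= conjcK.
Qed.

Lemma intT_poisson_poly z p : normc z < 1 ->
  intT (fun w => (poisson z w)%:C * p.[w]) = p.[z].
Proof.
move=> z1; have bk := bddC_cauchyk z1; have bp := bddC_poly p.
have -> : intT (fun w => (poisson z w)%:C * p.[w]) =
   intT (fun w => cauchyk z w * p.[w] + (cauchyk z w)^* * p.[w] - p.[w]).
  by apply: eq_intT => w w1; rewrite poissonE//; ring.
rewrite intTB//; last by apply: bddCD; apply: bddCM => //; exact: bddCJ.
rewrite intTD; [|exact: bddCM|by apply: bddCM => //; exact: bddCJ].
by rewrite intT_cauchyk_poly// intT_cauchykJ_poly// intT_poly addrK.
Qed.

(** The Schwarz integral recovers a polynomial from its real part up to an imaginary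
    constant; that constant becomes the unimodular factor of an outer function. *)
Lemma intT_schwarz_poly z p : normc z < 1 ->
  intT (fun w => (w + z) / (w - z) * (complex.Re p.[w])%:C) =
  p.[z] - (0 +i* complex.Im p.[0]).
Proof.
move=> z1; have bk := bddC_cauchyk z1; have bp := bddC_poly p.
have br : bddC (fun w => (complex.Re p.[w])%:C) by apply: bddC_real; case: bp.
have bJ : bddC (fun w => ((cauchyk z w)^* * p.[w])^*).
  by apply: bddCJ; apply: bddCM => //; exact: bddCJ.
have -> : intT (fun w => (w + z) / (w - z) * (complex.Re p.[w])%:C) =
   intT (fun w => cauchyk z w * p.[w] + ((cauchyk z w)^* * p.[w])^* - (complex.Re p.[w])%:C).
  apply: eq_intT => w w1; rewrite schwarz_kernelE// rmorphM/= conjcK.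
  rewrite mulrBl mul1r mulrAC -addcJ; ring.
rewrite intTB//; last by apply: bddCD => //; exact: bddCM.
rewrite intTD//; last exact: bddCM.
rewrite intT_cauchyk_poly// intTJ; last by apply: bddCM => //; exact: bddCJ.
rewrite intT_cauchykJ_poly// -addrA; congr (_ + _).
rewrite intT_real -Re_intT intT_poly.
by apply: complex_eqP; rewrite ?(Re_add, Re_opp, Im_add, Im_opp, Re_conjc, Im_conjc)/=; ring.
Qed.

End Kernels.

(** * Uniform limits of polynomials on the closed disc *)

Section DiscAlgebra.
Context {R : realType}.
Implicit Types (f g : R[i] -> R[i]) (z w c u : R[i]) (p : {poly R[i]}).

(** Uniform limits of polynomials on the closed disc. These functions are analytic
    inside and continuous up to the circle, and every integral identity for them follows
    from the case of polynomials. *)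
Definition disc_alg f : Prop := forall e : R, 0 < e ->
  exists p : {poly R[i]}, forall z, normc z <= 1 -> normc (f z - p.[z]) <= e.

Lemma disc_alg_cst c : disc_alg (fun=> c).
Proof. by move=> e e0; exists c%:P => z _; rewrite hornerC subrr normc0 ltW. Qed.

Lemma eq_disc_alg f g : (forall z, normc z <= 1 -> f z = g z) -> disc_alg f -> disc_alg g.
Proof. by move=> fg hf e /hf[p hp]; exists p => z z1; rewrite -fg// hp. Qed.

Lemma disc_alg_limit f :
  (forall e : R, 0 < e -> exists2 g, disc_alg g &
     forall z, normc z <= 1 -> normc (f z - g z) <= e) -> disc_alg f.
Proof.
move=> h e e0; have [g hg fg] := h (e / 2) (divr_gt0 e0 (ltr0n _ 2)).
have [p hp] := hg (e / 2) (divr_gt0 e0 (ltr0n _ 2)); exists p => z z1.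
rewrite -[f z](subrK (g z)) -addrA (le_trans (le_normcD _ _))//.
by rewrite [leRHS](splitr e) lerD ?fg ?hp.
Qed.

Lemma poly_disc_bounded p : exists2 M : R, 0 <= M & forall z, normc z <= 1 -> normc p.[z] <= M.
Proof.
exists (\sum_(i < size p) normc p`_i); first by rewrite sumr_ge0// => i _; exact: normc_ge0.
move=> z z1; rewrite horner_coef (le_trans (normc_sum _ _ _))// ler_sum// => i _.
by rewrite normcM normcX ler_piMr ?normc_ge0// exprn_ile1 ?normc_ge0.
Qed.

Lemma disc_alg_bounded f : disc_alg f ->
  exists2 M : R, 0 <= M & forall z, normc z <= 1 -> normc (f z) <= M.
Proof.
move=> /(_ 1 ltr01)[p hp]; have [M M0 hM] := poly_disc_bounded p.
exists (1 + M); first by rewrite addr_ge0.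
move=> z z1; rewrite -[f z](subrK p.[z]) (le_trans (le_normcD _ _))//.
by rewrite lerD ?hp ?hM.
Qed.

Lemma disc_algD f g : disc_alg f -> disc_alg g -> disc_alg (fun z => f z + g z).
Proof.
move=> hf hg e e0; have e2 := divr_gt0 e0 (ltr0n R 2).
have [p hp] := hf _ e2; have [q hq] := hg _ e2; exists (p + q) => z z1.
rewrite hornerD opprD addrACA (le_trans (le_normcD _ _))//.
by rewrite [leRHS](splitr e) lerD ?hp ?hq.
Qed.

Lemma disc_algM f g : disc_alg f -> disc_alg g -> disc_alg (fun z => f z * g z).
Proof.
move=> hf hg; have [F F0 hF] := disc_alg_bounded hf.
apply: disc_alg_limit => e e0.
have [q hq] := hg (e / (F + 1)) (divr_gt0 e0 (ltr_wpDl F0 ltr01)).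
exists (fun z => f z * q.[z]); last first.
  move=> z z1; rewrite -mulrBr normcM.
  rewrite (le_trans (ler_pM (normc_ge0 _) (normc_ge0 _) (hF z z1) (hq z z1)))//.
  rewrite mulrCA ler_piMr ?(ltW e0)// ler_pdivrMr; last lra.
  by rewrite mul1r lerDl.
have [G G0 hG] := poly_disc_bounded q => d d0.
have [p hp] := hf (d / (G + 1)) (divr_gt0 d0 (ltr_wpDl G0 ltr01)).
exists (p * q) => z z1; rewrite hornerM -mulrBl normcM.
rewrite (le_trans (ler_pM (normc_ge0 _) (normc_ge0 _) (hp z z1) (hG z z1)))//.
rewrite -mulrA ler_piMr ?(ltW d0)// mulrC ler_pdivrMr; last lra.
by rewrite mul1r lerDl.
Qed.

Lemma disc_algX f n : disc_alg f -> disc_alg (fun z => f z ^+ n).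
Proof.
move=> hf; elim: n => [|n IH].
  by apply: eq_disc_alg (disc_alg_cst 1) => z _; rewrite expr0.
by apply: eq_disc_alg (disc_algM hf IH) => z _; rewrite exprS.
Qed.

Lemma disc_alg_sum (I : Type) (r : seq I) (F : I -> R[i] -> R[i]) :
  (forall i, disc_alg (F i)) -> disc_alg (fun z => \sum_(i <- r) F i z).
Proof.
move=> hF; elim: r => [|i r IH].
  by apply: (@eq_disc_alg (fun=> 0)) => [z _|]; [rewrite big_nil|exact: disc_alg_cst].
by apply: (@eq_disc_alg (fun z => F i z + \sum_(j <- r) F j z)) => [z _|];
  [rewrite big_cons|exact: disc_algD].
Qed.

Lemma disc_alg_bddC f : disc_alg f -> bddC f.
Proof.
move=> hf; apply: bddC_uniform_limit => e /hf[p hp].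
by exists (fun z => p.[z]); [exact: bddC_poly|move=> w w1; rewrite hp// w1].
Qed.

(** An identity stable under uniform limits holds on the whole class as soon as it
    holds for polynomials; [L] is the difference of its two sides. *)
Lemma disc_alg_identity (L : (R[i] -> R[i]) -> R[i]) (C : R) f :
  (forall p, L (fun z => p.[z]) = 0) ->
  (forall p e, (forall z, normc z <= 1 -> normc (f z - p.[z]) <= e) ->
     normc (L f - L (fun z => p.[z])) <= C * e) ->
  disc_alg f -> L f = 0.
Proof.
move=> L0 LC hf; apply: eq0_normc; apply/eqP; rewrite eq_le normc_ge0 andbT.
apply/ler_addgt0Pl => e e0; rewrite addr0.
have C0 : 0 < `|C| + 1 by rewrite ltr_wpDl.
have [p hp] := hf (e / (`|C| + 1)) (divr_gt0 e0 C0).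
have := LC _ _ hp; rewrite L0 subr0 => /le_trans; apply.
rewrite mulrCA ler_piMr ?(ltW e0)// ler_pdivrMr// mul1r.
by rewrite (le_trans (ler_norm C))// lerDl.
Qed.

Lemma normc_intT_mulB (k f g : R[i] -> R[i]) (B e : R) : bddC k -> bddC f -> bddC g ->
  (forall w, normc w = 1 -> normc (k w) <= B) ->
  (forall w, normc w = 1 -> normc (f w - g w) <= e) ->
  normc (intT (fun w => k w * f w) - intT (fun w => k w * g w)) <= B * e + B * e.
Proof.
move=> bk bf bg hB hfg; rewrite -intTB; [|exact: bddCM..].
apply: normc_intT.
  apply: eq_bddC (bddCM bk (bddCD bf (bddCM (bddC_cst (-1)) bg))) => w _; ring.
move=> w w1; rewrite -mulrBr normcM ler_pM ?normc_ge0 ?hB ?hfg//.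
Qed.

Lemma hardy_coef_disc_alg f n : disc_alg f -> intT (fun w => f w * w ^+ n.+1) = 0.
Proof.
move=> hf; pose L g := intT (fun w : R[i] => w ^+ n.+1 * g w).
transitivity (L f); first by apply: eq_intT => w _; rewrite mulrC.
have bX := @bddCX R id n.+1 bddC_id.
have bf := disc_alg_bddC hf.
apply: (@disc_alg_identity L (1 + 1)) hf => [p|p e hp].
  rewrite /L; transitivity (intT (fun w => (p * 'X^(n.+1)).[w])).
    by apply: eq_intT => w _; rewrite hornerM hornerXn mulrC.
  by rewrite intT_poly hornerM hornerXn exprS mul0r mulr0.
rewrite mulrDl; apply: normc_intT_mulB => //.
- exact: bddC_poly.
- by move=> w w1; rewrite normcX w1 expr1n.
- by move=> w w1; rewrite hp// w1.
Qed.

Lemma disc_ext_disc_alg f z : disc_alg f -> normc z < 1 -> disc_ext f z = f z.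
Proof.
move=> hf z1; have bf := disc_alg_bddC hf.
have bP : bddC (fun w => (poisson z w)%:C) by apply: bddC_real; exact: bddT_poisson.
have [B B0 hB] := bddC_bounded bP.
pose L g := intT (fun w : R[i] => (poisson z w)%:C * g w) - g z.
apply/eqP; rewrite -subr_eq0; apply/eqP.
apply: (@disc_alg_identity L (B + B + 1)) hf => [p|p e hp].
  by rewrite /L intT_poisson_poly// subrr.
rewrite /L opprD addrACA -opprD (le_trans (le_normcD _ _))//.
rewrite normcN mulrDl mul1r lerD ?hp ?(ltW z1)//.
rewrite mulrDl. apply: normc_intT_mulB => //.
  exact: bddC_poly.
by move=> w w1; rewrite hp// w1.
Qed.

Lemma schwarz_disc_alg f z : disc_alg f -> normc z < 1 ->
  intT (fun w => (w + z) / (w - z) * (complex.Re (f w))%:C) =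
  f z - (0 +i* complex.Im (f 0)).
Proof.
move=> hf z1; have bf := disc_alg_bddC hf.
have bk : bddC (fun w => (w + z) / (w - z)).
  apply: (@eq_bddC _ (fun w => 2%:R * cauchyk z w + (-1))).
    by move=> w w1; rewrite schwarz_kernelE.
  apply: bddCD; last exact: bddC_cst.
  by apply: bddCM; [exact: bddC_cst|exact: bddC_cauchyk].
have bR g : bddC g -> bddC (fun w => (complex.Re (g w))%:C).
  by case=> h _; exact: bddC_real.
have [B B0 hB] := bddC_bounded bk.
pose L g := intT (fun w : R[i] => (w + z) / (w - z) * (complex.Re (g w))%:C)
  - (g z - (0 +i* complex.Im (g 0))).
apply/eqP; rewrite -subr_eq0; apply/eqP.
apply: (@disc_alg_identity L (B + B + (1 + 1))) hf => [p|p e hp].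
  by rewrite /L intT_schwarz_poly// subrr.
have shuffle (x y u v : R[i]) : x - y - (u - v) = (x - u) + - (y - v) by ring.
rewrite /L shuffle (le_trans (le_normcD _ _))// normcN [leRHS]mulrDl lerD//.
  rewrite mulrDl; apply: (@normc_intT_mulB (fun w => (w + z) / (w - z))
    (fun w => (complex.Re (f w))%:C) (fun w => (complex.Re p.[w])%:C)) => //.
  - exact: bR.
  - exact/bR/bddC_poly.
  - move=> w w1; have -> : (complex.Re (f w))%:C - (complex.Re p.[w])%:C = (complex.Re (f w - p.[w]))%:C.
      by rewrite Re_add Re_opp rmorphB.
    rewrite normc_real (le_trans (le_Re_normc _))//.
    by rewrite hp// w1.
rewrite shuffle (le_trans (le_normcD _ _))// normcN mulrDl mul1r lerD ?hp ?(ltW z1)//.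
have -> : 0 +i* complex.Im (f 0) - (0 +i* complex.Im p.[0]) =
   0 +i* complex.Im (f 0 - p.[0]) by rewrite Im_add Im_opp; simpc.
rewrite /= expr0n add0r sqrtr_sqr (le_trans (le_Im_normc _))// hp//.
by rewrite normc0.
Qed.

Lemma is_derive_littleo (g : R -> R) (l : R) : is_derive (0 : R) (1 : R) g l ->
  forall eta : R, 0 < eta -> exists2 d : R, 0 < d &
    forall y : R, `|y| < d -> `|g y - g 0 - y * l| <= eta * `|y|.
Proof.
move=> [dg gl] eta eta0.
have /cvgrPdist_le/(_ _ eta0) : (fun h : R => h^-1 *: (g (h *: 1 + 0) - g 0)) @ 0^' --> l.
  by rewrite -gl; exact: dg.
move=> /nbhs_ballP[d /= d0 hd].
exists d => // y yd; have [->|y0] := eqVneq y 0.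
  by rewrite subrr mul0r subrr normr0 mulr0.
have yb : ball (0 : R) d y by rewrite -ball_normE /ball_/= sub0r normrN.
have := hd y yb y0; rewrite /= addr0 /GRing.scale/= mulr1 => h.
have -> : g y - g 0 - y * l = - (y * (l - y^-1 * (g y - g 0))).
  by rewrite mulrBr mulrA divff// mul1r opprB.
by rewrite normrN normrM mulrC ler_wpM2r.
Qed.

Lemma normc_cexp u : normc (cexp u) = expR (complex.Re u).
Proof. by rewrite normcM normc_circ mulr1 normc_real gtr0_norm// expR_gt0. Qed.

Lemma cexpD u v : cexp (u + v) = cexp u * cexp v.
Proof. by rewrite /cexp Re_add Im_add circD expRD rmorphM/=; ring. Qed.

Lemma cexp0 : cexp (0 : R[i]) = 1.
Proof. by rewrite /cexp expR0 circ0 mulr1. Qed.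

Lemma cexpMn u n : cexp (u *+ n) = cexp u ^+ n.
Proof.
elim: n => [|n IH]; first by rewrite mulr0n cexp0.
by rewrite mulrS cexpD IH exprS.
Qed.

End DiscAlgebra.

(** * Exponentials in the disc algebra *)

Section ExpLog.
Context {R : realType}.
Implicit Types (f g : R[i] -> R[i]) (z w c u v : R[i]) (p : {poly R[i]}).

(** Besides the functional equation, this is all that the approximation of the complex
    exponential by polynomials needs. *)
Lemma cexp_first_order (eta : R) : 0 < eta -> exists2 d : R, 0 < d &
  forall v, normc v < d -> normc (cexp v - (1 + v)) <= eta * normc v.
Proof.
move=> eta0; pose a : R := Num.min eta 1 / 16.
have a0 : 0 < a by rewrite divr_gt0// lt_min eta0 ltr01.
have a_eta : 16 * a <= eta by rewrite /a mulrC divfK ?ge_min ?lexx.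
have a1 : 16 * a <= 1 by rewrite /a mulrC divfK ?ge_min ?lexx ?orbT.
have [d1 d10 h1] := is_derive_littleo (is_derive_expR 0) a0.
have [d2 d20 h2] := is_derive_littleo (is_derive_cos 0) a0.
have [d3 d30 h3] := is_derive_littleo (is_derive_sin 0) a0.
(* The radius is also at most [a], so that the products of two small terms are absorbed. *)
exists (Num.min (Num.min d1 d2) (Num.min d3 a)).
  by rewrite !lt_min d10 d20 d30 a0.
move=> v; rewrite !lt_min => /andP[/andP[v1 v2] /andP[v3 va]].
have xv := le_Re_normc v; have yv := le_Im_normc v.
have hE := h1 _ (le_lt_trans xv v1); have hC := h2 _ (le_lt_trans yv v2).
have hS := h3 _ (le_lt_trans yv v3).
rewrite (le_trans (normc_le_ReIm _))//.
rewrite /cexp Re_add Im_add Re_opp Im_opp Re_mul Im_mul Re_add Im_add /= !mul0r subr0 addr0 add0r.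
rewrite sin0 subr0 cos0 mulr1 in hS; rewrite cos0 sin0 oppr0 mulr0 subr0 in hC.
rewrite expR0 mulr1 in hE.
set x := complex.Re v in xv hE *; set y := complex.Im v in yv hC hS *.
clearbody x y; move: (expR x) (expR_gt0 x) hE => E E0 hE.
move: (sin y) (cos y) hS hC => S C hS hC.
have vn := normc_ge0 v; move: (normc v) vn va xv yv v1 v2 v3 => n n0 na xn yn _ _ _.
have x0 := normr_ge0 x; have y0 := normr_ge0 y.
have E3 : E <= 3.
  have := ler_norm (E - 1 - x); have := ler_norm x; nra.
have EB : `|E - 1| <= 2 * `|x|.
  have -> : E - 1 = (E - 1 - x) + x by ring.
  rewrite (le_trans (ler_normD _ _))//; nra.
have -> : E * C - (1 + x) = (E - 1 - x) + E * (C - 1) by ring.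
have -> : E * S - y = E * (S - y) + (E - 1) * y by ring.
have t1 := ler_normD (E - 1 - x) (E * (C - 1)).
have t2 := ler_normD (E * (S - y)) ((E - 1) * y).
rewrite !normrM (gtr0_norm E0) in t1 t2.
have t3 : E * `|C - 1| <= 3 * (a * `|y|) by apply: ler_pM => //; lra.
have t4 : E * `|S - y| <= 3 * (a * `|y|) by apply: ler_pM => //; lra.
have t5 : `|E - 1| * `|y| <= (2 * a) * `|y|.
  by apply: ler_wpM2r => //; rewrite (le_trans EB)//; lra.
have t6 : a * `|x| <= a * n by rewrite ler_pM2l.
have t7 : a * `|y| <= a * n by rewrite ler_pM2l.
have t8 : 16 * a * n <= eta * n by rewrite ler_wpM2r.
nra.
Qed.

Lemma subX_le (a b : R[i]) (M : R) n : normc a <= M -> normc b <= M -> 0 <= M ->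
  normc (a ^+ n - b ^+ n) <= normc (a - b) * (n%:R * M ^+ n.-1).
Proof.
move=> aM bM M0; rewrite subrXX normcM ler_wpM2l ?normc_ge0//.
rewrite (le_trans (normc_sum _ _ _))//.
have -> : n%:R * M ^+ n.-1 = \sum_(i < n) M ^+ n.-1 by rewrite sumr_const card_ord mulr_natl.
apply: ler_sum => i _; rewrite normcM !normcX.
have -> : M ^+ n.-1 = M ^+ (n.-1 - i) * M ^+ i.
  by rewrite -exprD subnK// -ltnS prednK//; case: n i => [[]|].
by rewrite ler_pM ?exprn_ge0 ?normc_ge0// lerXn2r// ?nnegrE ?normc_ge0.
Qed.

(** Compares [exp u = exp (u / n) ^ n] with [(1 + u / n) ^ n]. The factors differ by
    [o (1 / n)] uniformly for bounded [u], and the second power is again a uniform limit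
    of polynomials. *)
Lemma disc_alg_cexp f : disc_alg f -> disc_alg (fun z => cexp (f z)).
Proof.
move=> hf; have [B B0 hB] := disc_alg_bounded hf.
apply: disc_alg_limit => e e0.
have BE0 : 0 < (B + 1) * expR B by rewrite mulr_gt0 ?expR_gt0// ltr_wpDl.
have [d d0 hd] := cexp_first_order (divr_gt0 e0 BE0).
have [n nB] : exists n : nat, (B + 1) / d < n.+1%:R.
  exists (Num.bound ((B + 1) / d)).
  rewrite (lt_trans (archi_boundP _)) ?ltr_nat// divr_ge0 ?ltW//.
  by rewrite ltr_wpDl.
have n0 : 0 < n.+1%:R :> R by rewrite ltr0n.
pose r : R[i] := (n.+1%:R^-1 : R)%:C.
have nr : normc r = n.+1%:R^-1 by rewrite normc_real ger0_norm// invr_ge0 ltW.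
exists (fun z => (1 + r * f z) ^+ n.+1).
  apply: disc_algX; apply: disc_algD; first exact: disc_alg_cst.
  by apply: disc_algM => //; exact: disc_alg_cst.
move=> z /hB; move: (f z) => u uB.
have -> : cexp u = cexp (r * u) ^+ n.+1.
  rewrite -cexpMn -mulr_natl mulrA; congr cexp.
  have -> : n.+1%:R * r = 1 by rewrite /r -(rmorph_nat (real_complex R)) -rmorphM/= divff// gt_eqF.
  by rewrite mul1r.
have vB : normc (r * u) <= B / n.+1%:R by rewrite normcM nr mulrC ler_wpM2r// invr_ge0 ltW.
have vd : normc (r * u) < d.
  rewrite (le_lt_trans vB)// ltr_pdivrMr// mulrC -ltr_pdivrMr//.
  by rewrite (le_lt_trans _ nB)// ler_wpM2r ?invr_ge0 ?(ltW d0)// lerDl.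
have vR : complex.Re (r * u) <= B / n.+1%:R.
  by rewrite (le_trans (ler_norm _))// (le_trans (le_Re_normc _)).
rewrite (le_trans (subX_le n.+1 (M := expR (B / n.+1%:R)) _ _ _)) ?expR_ge0//.
- by rewrite normc_cexp ler_expR.
- rewrite (le_trans (le_normcD _ _))// normc1 (le_trans _ (expR_ge1Dx _))//.
  by rewrite lerD2l.
rewrite (le_trans (ler_wpM2r _ (hd _ vd))) ?mulr_ge0 ?exprn_ge0 ?expR_ge0 ?ler0n//.
rewrite (@le_trans _ _ (e / ((B + 1) * expR B) * (B / n.+1%:R) * (n.+1%:R * expR B)))//.
  apply: ler_pM.
  - by rewrite mulr_ge0 ?normc_ge0// divr_ge0// ltW.
  - by rewrite mulr_ge0 ?exprn_ge0 ?expR_ge0// ltW.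
  - by rewrite ler_wpM2l// divr_ge0// ltW.
  rewrite ler_wpM2l ?ler0n//= -expRM_natl ler_expR mulrA [n%:R * B]mulrC -mulrA.
  by rewrite ler_piMr// ler_pdivrMr// mul1r ler_nat.
have E0 := expR_gt0 B.
have -> : e / ((B + 1) * expR B) * (B / n.+1%:R) * (n.+1%:R * expR B) = e * (B / (B + 1)).
  by field; rewrite !gt_eqF//; lra.
by rewrite ler_piMr ?(ltW e0)// ler_pdivrMr; lra.
Qed.

End ExpLog.

(** * A logarithm of 1 - bz *)

Section LogDisc.
Context {R : realType}.
Implicit Types (z w c u v zeta : R[i]) (p : {poly R[i]}).

Lemma derive_bound01 (f df : R -> R) (M : R) :
  (forall s : R, 0 <= s <= 1 -> is_derive s (1 : R) f (df s)) ->
  (forall s : R, 0 <= s <= 1 -> `|df s| <= M) -> `|f 1 - f 0| <= M.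
Proof.
move=> hf hM.
have [||s] := @MVT_segment R f df 0 1 ler01.
- by move=> s; rewrite in_itv/= => /andP[s0 s1]; apply: hf; rewrite !ltW.
- by apply: derivable_within_continuous => s; rewrite in_itv/= => /hf[].
by rewrite in_itv/= => hs ->; rewrite subr0 mulr1 hM.
Qed.

Lemma is_derive_ln_sqr (x y s : R) : 0 < (1 - s * x) ^+ 2 + (s * y) ^+ 2 ->
  is_derive s (1 : R) (fun s => ln ((1 - s * x) ^+ 2 + (s * y) ^+ 2))
    ((- (2 * x * (1 - s * x)) + 2 * s * y ^+ 2) / ((1 - s * x) ^+ 2 + (s * y) ^+ 2)).
Proof.
move=> h; pose P : {poly R} := (1 - 'X * x%:P) ^+ 2 + ('X * y%:P) ^+ 2.
have E t : (1 - t * x) ^+ 2 + (t * y) ^+ 2 = P.[t].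
  by rewrite /P !(hornerE, horner_exp).
have -> : (fun s => ln ((1 - s * x) ^+ 2 + (s * y) ^+ 2)) = @ln R \o horner P.
  by apply/funext => t /=; rewrite E.
rewrite !E in h *.
apply: (is_derive_eq (is_derive1_comp (is_derive1_ln h) (is_derive_poly P s))).
rewrite mulrC; congr (_ / _).
by rewrite /P !poly.derivE !(hornerE, horner_exp)/=; ring.
Qed.

Lemma is_derive_atan_ratio (x y s : R) : 1 - s * x != 0 ->
  is_derive s (1 : R) (fun s => atan (- (s * y) / (1 - s * x)))
    (- y / ((1 - s * x) ^+ 2 + (s * y) ^+ 2)).
Proof.
move=> h; pose P : {poly R} := - ('X * y%:P); pose Q : {poly R} := 1 - 'X * x%:P.
have PE t : - (t * y) = P.[t] by rewrite /P !hornerE.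
have QE t : 1 - t * x = Q.[t] by rewrite /Q !hornerE.
have -> : (fun s => atan (- (s * y) / (1 - s * x))) =
    @atan R \o (horner P * (fun t => (horner Q t)^-1)).
  by apply/funext => t /=; rewrite PE QE.
have hQ := h; rewrite QE in hQ.
have dQ := is_deriveV hQ (is_derive_poly Q s).
have dPQ := is_deriveM (is_derive_poly P s) dQ.
apply: (is_derive_eq (is_derive1_comp (is_derive1_atan _) dPQ)).
have P1 : P^`().[s] = - y by rewrite /P !poly.derivE !hornerE/=; ring.
have Q1 : Q^`().[s] = - x by rewrite /Q !poly.derivE !hornerE/=; ring.
have fE : (horner P * (fun t => (horner Q t)^-1)) s = - (s * y) / (1 - s * x) by rewrite PE QE.
rewrite fE P1 Q1 /= -PE -QE /GRing.scale/=.
have h2 : 0 < (1 - s * x) ^+ 2 by rewrite lt_neqAle sqr_ge0 andbT eq_sym sqrf_eq0.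
have h3 : 0 < (1 - s * x) ^+ 2 + (s * y) ^+ 2 by rewrite ltr_wpDr ?sqr_ge0.
field; rewrite h gt_eqF//=; nra.
Qed.

(** The principal logarithm of [1 - zeta], the argument being an arc tangent because
    [1 - zeta] has positive real part. *)
Definition clog1m zeta : R[i] := ln (normc (1 - zeta)) +i*
  atan (- complex.Im zeta / (1 - complex.Re zeta)).

Definition log_series zeta n : R[i] :=
  \sum_(k < n) zeta ^+ k.+1 * ((k.+1%:R^-1 : R)%:C).

(** Along the segment from [0] to [zeta] the derivative of the logarithm plus its
    partial sum is the remainder of a geometric series, and the mean value inequality
    applies. The mean value theorem being one about real functions, the statement is for a
    real linear functional of the difference; the real and the imaginary part are two
    instances. *)
Lemma clog1m_series_component (a b : R) zeta n : normc zeta < 1 ->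
  `|a * complex.Re (clog1m zeta + log_series zeta n)
    + b * complex.Im (clog1m zeta + log_series zeta n)| <=
  (`|a| + `|b|) * (normc zeta ^+ n / (1 - normc zeta)).
Proof.
move=> z1; pose l z := a * complex.Re z + b * complex.Im z.
rewrite -/(l _).
have lD u v : l (u + v) = l u + l v by rewrite /l Re_add Im_add; ring.
have lZ u (t : R) : l (u * t%:C) = l u * t by rewrite /l Re_mul Im_mul /=; ring.
have l_sum (F : 'I_n -> R[i]) : l (\sum_i F i) = \sum_i l (F i).
  by apply: (big_morph l lD); rewrite /l /= !mulr0 addr0.
have l_le u : `|l u| <= (`|a| + `|b|) * normc u.
  rewrite (le_trans (ler_normD _ _))// !normrM mulrDl.
  by rewrite lerD// ler_wpM2l// ?le_Re_normc ?le_Im_normc.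
set x := complex.Re zeta; set y := complex.Im zeta.
have xyE (s : R) : (1 - s * x) ^+ 2 + (s * y) ^+ 2 = normc (1 - zeta * s%:C) ^+ 2.
  rewrite sqr_normc_ReIm Re_add Im_add Re_opp Im_opp Re_mul Im_mul /= -/x -/y; ring.
have zs1 (s : R) : 0 <= s <= 1 -> normc (zeta * s%:C) <= normc zeta.
  move=> /andP[s0 s1]; rewrite normcM normc_real ger0_norm//.
  by rewrite ler_piMr ?normc_ge0.
have zs_lt (s : R) : 0 <= s <= 1 -> normc (zeta * s%:C) < 1.
  by move=> /zs1 /le_lt_trans; apply.
have xs (s : R) : 0 <= s <= 1 -> 1 - s * x != 0.
  move=> /zs_lt; move=> /(le_lt_trans (le_Re_normc _)); rewrite Re_mul /= mulr0 subr0 mulrC -/x.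
  move=> h; have hn := ler_norm (s * x); rewrite gt_eqF//; lra.
have nz (s : R) : 0 <= s <= 1 -> 0 < normc (1 - zeta * s%:C) ^+ 2.
  by move=> hs; rewrite exprn_gt0// normc_gt0 oneB_neq0// zs_lt.
pose P : {poly R} := \sum_(k < n) (l (zeta ^+ k.+1) / k.+1%:R) *: 'X^(k.+1).
have PE s : P.[s] = \sum_(k < n) l (zeta ^+ k.+1) / k.+1%:R * s ^+ k.+1.
  by rewrite /P horner_sum; apply: eq_bigr => k _; rewrite hornerZ hornerXn.
have P'E s : P^`().[s] = \sum_(k < n) l (zeta ^+ k.+1) * s ^+ k.
  rewrite /P raddf_sum horner_sum; apply: eq_bigr => k _ /=.
  rewrite derivZ derivXn hornerZ hornerMn hornerXn.
  by rewrite /= mulrnAr -mulrnAl -(mulr_natr (l _ / _)) mulfVK ?pnatr_eq0.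
pose D s := a / 2 * ln ((1 - s * x) ^+ 2 + (s * y) ^+ 2)
  + b * atan (- (s * y) / (1 - s * x)) + P.[s].
have D0 : D 0 = 0.
  rewrite /D !mul0r subr0 expr1n expr0n addr0 ln1 oppr0 mul0r atan0 !mulr0 !add0r.
  by rewrite PE big1// => k _; rewrite [0 ^+ _]exprS mul0r mulr0.
have D1 : D 1 = l (clog1m zeta + log_series zeta n).
  rewrite /D lD; congr (_ + _).
    rewrite xyE mulr1 lnXn ?normc_gt0; last first.
      by rewrite oneB_neq0.
    by rewrite !mul1r /l/= -/x -/y; congr (_ + _); field.
  rewrite PE /log_series l_sum; apply: eq_bigr => k _.
  by rewrite lZ expr1n mulr1.
rewrite -D1 -[D 1]subr0 -D0.
pose D' s := l (- (zeta * (zeta * s%:C) ^+ n / (1 - zeta * s%:C))).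
apply: (@derive_bound01 D D') => s hs.
- have h1 := is_derive_ln_sqr (x := x) (y := y) (s := s).
  rewrite xyE in h1; have {}h1 := h1 (nz _ hs).
  have h2 := is_derive_atan_ratio y (xs _ hs); rewrite xyE in h2.
  have := is_deriveD (is_deriveD (is_deriveZ (a / 2) h1) (is_deriveZ b h2)) (is_derive_poly P s).
  move=> h3; apply: (is_derive_eq h3).
  rewrite /GRing.scale/= P'E.
  have -> : \sum_(k < n) l (zeta ^+ k.+1) * s ^+ k = l (zeta * \sum_(k < n) (zeta * s%:C) ^+ k).
    rewrite mulr_sumr l_sum; apply: eq_bigr => k _.
    by rewrite exprMn -rmorphXn/= mulrA lZ exprS.
  have g := sub_geometric n (zs_lt _ hs).
  rewrite /D' -[zeta * _ / _]mulrA -g.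
  have -> : - (zeta * ((1 - zeta * s%:C)^-1 - \sum_(k < n) (zeta * s%:C) ^+ k)) =
    - (zeta * (1 - zeta * s%:C)^-1) + zeta * \sum_(k < n) (zeta * s%:C) ^+ k by ring.
  rewrite lD; congr (_ + _).
  have -> : - (zeta * (1 - zeta * s%:C)^-1) =
     - (zeta * (1 - zeta * s%:C)^*) * ((normc (1 - zeta * s%:C) ^- 2 : R)%:C).
    rewrite mulNr -mulrA; congr (- (_ * _)).
    have n0 : 1 - zeta * s%:C != 0 by rewrite oneB_neq0// zs_lt.
    apply: (mulfI n0); rewrite divff// mulrA mulc_conj -rmorphM/= divff//.
    by rewrite gt_eqF// nz.
  rewrite lZ /l !Re_opp !Im_opp Re_mul Im_mul Re_conjc Im_conjc Re_add Im_add Re_opp Im_opp Re_mul Im_mul /=.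
  by rewrite -/x -/y; field; rewrite gt_eqF// normc_gt0 oneB_neq0// zs_lt.
- rewrite (le_trans (l_le _))// ler_wpM2l ?addr_ge0// normcN normcM normcV normcM normcX.
  have z0 := normc_ge0 zeta.
  apply: ler_pM.
  + by rewrite mulr_ge0 ?exprn_ge0 ?normc_ge0.
  + by rewrite invr_ge0 normc_ge0.
  + rewrite -[leRHS]mul1r; apply: ler_pM; rewrite ?exprn_ge0 ?normc_ge0 ?(ltW z1)//.
    by rewrite lerXn2r ?nnegrE ?normc_ge0// zs1.
  + rewrite lef_pV2 ?posrE ?subr_gt0 ?normc_gt0 ?oneB_neq0 ?zs_lt//.
    rewrite (le_trans _ (normc_1B_ge _))// lerD2l lerN2 zs1//.
Qed.

Lemma disc_alg_clog1m b : normc b < 1 -> disc_alg (fun z => clog1m (b * z)).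
Proof.
move=> b1 e e0.
have b10 : 0 < 1 - normc b by rewrite subr_gt0.
have [n hn] := exists_expr_lt (normc_ge0 b) b1 (mulr_gt0 (divr_gt0 e0 (ltr0n R 2)) b10).
exists (- \sum_(k < n) ((b ^+ k.+1 * ((k.+1%:R^-1 : R)%:C)) *: 'X^(k.+1))) => z z1.
have -> : (- \sum_(k < n) ((b ^+ k.+1 * ((k.+1%:R^-1 : R)%:C)) *: 'X^(k.+1))).[z]
    = - log_series (b * z) n.
  rewrite hornerN horner_sum; congr (- _); apply: eq_bigr => k _.
  by rewrite hornerZ hornerXn exprMn; ring.
rewrite opprK.
have bz : normc (b * z) <= normc b by rewrite normcM ler_piMr ?normc_ge0.
have bz1 := le_lt_trans bz b1.
have small : normc (b * z) ^+ n / (1 - normc (b * z)) <= e / 2.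
  rewrite ler_pdivrMr ?subr_gt0// (@le_trans _ _ (e / 2 * (1 - normc b)))//.
    by rewrite (le_trans _ (ltW hn))// lerXn2r ?nnegrE ?normc_ge0.
  by rewrite ler_wpM2l ?divr_ge0 ?(ltW e0)// lerD2l lerN2.
have := clog1m_series_component 1 0 n bz1; have := clog1m_series_component 0 1 n bz1.
rewrite /= normr0 normr1 add0r addr0 !mul1r !mul0r add0r addr0 => hI hR.
by rewrite (le_trans (normc_le_ReIm _))// [leRHS]splitr lerD// ?(le_trans hR) ?(le_trans hI).
Qed.

End LogDisc.

(** * Outer functions whose modulus comes from a Poisson mixture *)

Section OuterFunctions.
Context {R : realType}.
Implicit Types (f g h : R[i] -> R[i]) (z w c u v : R[i]) (p q : {poly R[i]}).

Lemma normT_integralE (r : R) f :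
  normT r f = ((\int[haarT R]_x (normc (f (circ x)) `^ r)%:E) `^ r^-1)%E.
Proof.
rewrite /normT unlock /=; congr (_ `^ _)%E; apply: eq_integral => x _.
by rewrite ger0_norm ?normc_ge0.
Qed.

Lemma normT_lty (r : R) f : 0 < r -> bddC f -> (normT r f < +oo)%E.
Proof.
move=> r0 bf; rewrite normT_integralE.
have bT := bddT_powR (bddC_normc bf) (ltW r0).
have : (\int[haarT R]_x (normc (f (circ x)) `^ r)%:E < +oo)%E.
  have := integrable_lty measurableT (bddT_integrable bT).
  by under eq_integral do rewrite /= ger0_norm ?normc_ge0//.
have : (0 <= \int[haarT R]_x (normc (f (circ x)) `^ r)%:E)%E.
  by apply: integral_ge0 => x _; rewrite lee_fin powR_ge0.
by case: (integral _ _ _) => //= x _ _; rewrite ltry.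
Qed.

Lemma hardy_disc_alg (r : R) f : 0 < r -> disc_alg f -> hardy r f.
Proof.
move=> r0 hf; have bf := disc_alg_bddC hf.
split; [exact: bddC_measT|exact: normT_lty|].
move=> [n|n]//= _; rewrite /fourierT -[RHS](hardy_coef_disc_alg n hf).
by apply: eq_intT => w _; rewrite NegzE opprK.
Qed.

(** The modulus of [exp f] has logarithm the real part of [f], so that the formula for
    outer functions is the Schwarz formula for [f], exponentiated. *)
Lemma outer_cexp f : disc_alg f -> outer (fun z => cexp (f z)).
Proof.
move=> hf; have bf := disc_alg_bddC hf.
have lnE z : ln (normc (cexp (f z))) = complex.Re (f z) by rewrite normc_cexp expRK.
split.
- apply: aeW => x; rewrite -normc_gt0 normc_cexp; exact: expR_gt0.
- have := bddT_integrable (proj1 bf).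
  by apply: eq_integrable => // x _ /=; rewrite lnE.
- exists (cexp (0 +i* complex.Im (f 0))); first by rewrite normc_cexp expR0.
  move=> z z1; rewrite disc_ext_disc_alg//; last exact: disc_alg_cexp.
  rewrite -cexpD; congr cexp.
  rewrite (eq_intT (g := fun w => (w + z) / (w - z) * (complex.Re (f w))%:C)).
    by rewrite schwarz_disc_alg// addrC subrK.
  by move=> w _; rewrite lnE.
Qed.

(** The moduli that the factorization below handles: a polynomial and an exponential
    of the disc algebra with the same modulus on the circle. *)
Definition log_modulus q : Prop := exists2 f, disc_alg f &
  forall w, normc w = 1 -> expR (complex.Re (f w)) = normc q.[w].

Lemma expR_Re_clog1m zeta : normc zeta < 1 ->
  expR (complex.Re (@clog1m R zeta)) = normc (1 - zeta).
Proof. by move=> z1; rewrite /= lnK// posrE normc_gt0 oneB_neq0. Qed.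

Lemma log_modulusC c : c != 0 -> log_modulus c%:P.
Proof.
move=> c0; exists (fun=> (ln (normc c))%:C); first exact: disc_alg_cst.
by move=> w _; rewrite /= lnK ?hornerC// posrE normc_gt0.
Qed.

Lemma log_modulusM p q : log_modulus p -> log_modulus q -> log_modulus (p * q).
Proof.
move=> [f hf fE] [g hg gE]; exists (fun z => f z + g z); first exact: disc_algD.
by move=> w w1; rewrite Re_add expRD fE// gE// hornerM normcM.
Qed.

Lemma log_modulus_linear b : normc b < 1 -> log_modulus (1 - b *: 'X).
Proof.
move=> b1; exists (fun z => clog1m (b * z)); first exact: disc_alg_clog1m.
move=> w w1; rewrite expR_Re_clog1m ?hornerE//.
by rewrite normcM w1 mulr1.
Qed.

(** A root inside the disc is reflected to its inverse conjugate: on the circle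
    [|w - b| = |1 - b^* w|], and the right-hand side has a logarithm in the disc algebra. *)
Lemma log_modulus_XsubC b : normc b != 1 -> log_modulus ('X - b%:P).
Proof.
rewrite neq_lt => /orP[b1|b1].
- have [|f hf fE] := @log_modulus_linear b^*; first by rewrite normc_conj.
  exists f => // w w1; rewrite fE// !hornerE.
  have -> : w - b = w * (1 - b^* * w)^*.
    rewrite rmorphB rmorph1 rmorphM/= conjcK mulrBr mulr1 mulrCA.
    by rewrite mulc_conj w1 expr1n mulr1.
  by rewrite normcM w1 mul1r normc_conj.
- have b0 : b != 0 by rewrite -normc_gt0 (lt_trans _ b1).
  have hb : normc (b^-1) < 1 by rewrite normcV invf_lt1// normc_gt0.
  have [f hf fE] := log_modulusM (log_modulusC b0) (log_modulus_linear hb).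
  exists f => // w w1; rewrite fE// hornerM !hornerE mulrBr mulr1 mulrA divff// mul1r.
  by rewrite normc_distC.
Qed.

(** Splits the polynomial into linear factors. Only moduli matter, so the roots need
    not be paired as in the Fejer-Riesz theorem. *)
Lemma log_modulus_circle q : (forall w, normc w = 1 -> q.[w] != 0) -> log_modulus q.
Proof.
move=> q0; have [r qE] := closed_field_poly_normal q.
have lq0 : lead_coef q != 0.
  rewrite lead_coef_eq0; apply/eqP => qz; have := q0 1 (normc1 R).
  by rewrite qz horner0 eqxx.
have rq z : z \in r -> normc z != 1.
  move=> zr; apply/eqP => /q0; rewrite qE hornerZ horner_prod.
  by rewrite (big_rem z)//= hornerXsubC subrr mul0r mulr0 eqxx.
rewrite qE -mul_polyC; apply: log_modulusM; first exact: log_modulusC.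
elim: r rq {qE} => [|z r IH] rq.
  by rewrite big_nil -[1]/(1%:P); exact/log_modulusC/oner_neq0.
rewrite big_cons; apply: log_modulusM.
  by apply: log_modulus_XsubC; rewrite rq// mem_head.
by apply: IH => y yr; rewrite rq// in_cons yr orbT.
Qed.

(** Clearing denominators turns the mixture into the modulus of a polynomial [q]:
    on the circle [(1 - a^* w) (w - a) = w * |1 - a^* w| ^ 2]. Since Poisson kernels are
    positive, [q] has no zero on the circle. *)
Lemma poisson_mixture_log K (a : 'I_K -> R[i]) (c : 'I_K -> R) :
  (forall k, normc (a k) < 1) -> (forall k, 0 <= c k) -> \sum_k c k = 1 ->
  exists2 f, disc_alg f & forall w, normc w = 1 ->
    expR (complex.Re (f w)) = \sum_k c k * poisson (a k) w.
Proof.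
move=> a1 c0 c1.
pose A k := 1 - (a k)^* *: 'X : {poly R[i]}.
pose B k := 'X - (a k)%:P : {poly R[i]}.
pose q : {poly R[i]} := \sum_k ((c k * (1 - normc (a k) ^+ 2))%:C)%:P *
  \prod_(j | j != k) (A j * B j).
have AE k w : (A k).[w] = 1 - (a k)^* * w by rewrite !hornerE.
have Apos k w : normc w = 1 -> 0 < normc (A k).[w].
  by move=> w1; rewrite AE normc_gt0 oneB_neq0// normcM normc_conj w1 mulr1.
have ABE k w : normc w = 1 -> (A k * B k).[w] = w * (normc (A k).[w] ^+ 2)%:C.
  move=> w1; rewrite -mulc_conj hornerM mulrCA; congr (_ * _).
  rewrite AE /B !hornerE rmorphB rmorph1 rmorphM/= conjcK mulrBr mulr1 mulrCA.
  by rewrite mulc_conj w1 expr1n mulr1.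
pose g w : R := \sum_k c k * poisson (a k) w.
have gpos w : normc w = 1 -> 0 < g w.
  move=> w1.
  have [k ck] : exists k, 0 < c k.
    apply/existsP; apply: contraT; rewrite negb_exists => /forallP h.
    move: c1; rewrite big1 => [/eqP|k _]; first by rewrite eq_sym oner_eq0.
    by apply/eqP; rewrite eq_le c0 andbT leNgt h.
  rewrite /g (bigD1 k)//= ltr_pwDl//; first exact: (mulr_gt0 ck (poisson_gt0 (a1 k) w1)).
  by apply: sumr_ge0 => j _; rewrite mulr_ge0// poisson_ge0.
have qE w : normc w = 1 ->
    q.[w] = w ^+ K.-1 * (\prod_k normc (A k).[w] ^+ 2)%:C * (g w)%:C.
  move=> w1; rewrite /q horner_sum rmorph_sum mulr_sumr; apply: eq_bigr => k _.
  rewrite hornerM hornerC horner_prod.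
  rewrite (eq_bigr (fun j => w * (normc (A j).[w] ^+ 2)%:C)) => [|j _]; last exact: ABE.
  rewrite big_split/= prodr_const cardC1 card_ord -rmorph_prod/=.
  rewrite [in RHS](bigD1 k)//= mulrCA -!mulrA; congr (_ * _).
  rewrite -!rmorphM/=; congr (_ %:C).
  have -> : poisson (a k) w = (1 - normc (a k) ^+ 2) / normc (A k).[w] ^+ 2 by rewrite AE.
  move: (\prod_(_ < _ | _) _) (normc (A k).[w]) (Apos k w w1) => P x x0.
  by field; rewrite gt_eqF.
have [w w1|f hf fE] := log_modulus_circle (q := q).
  rewrite -normc_gt0 qE// !normcM normcX w1 expr1n mul1r mulr_gt0// !normc_real.
    by rewrite normr_gt0 gt_eqF// prodr_gt0// => k _; rewrite exprn_gt0// Apos.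
  by rewrite normr_gt0 gt_eqF// gpos.
exists (fun z => f z + (-2%:R) * \sum_k clog1m ((a k)^* * z)).
  apply: disc_algD => //; apply: disc_algM; first exact: disc_alg_cst.
  by apply: disc_alg_sum => k; apply: disc_alg_clog1m; rewrite normc_conj.
move=> w w1; rewrite Re_add expRD fE// qE//.
have P0 : 0 < \prod_k normc (A k).[w] ^+ 2.
  by apply: prodr_gt0 => k _; rewrite exprn_gt0// Apos.
have -> : expR (complex.Re (-2%:R * \sum_k clog1m ((a k)^* * w))) =
    (\prod_k normc (A k).[w] ^+ 2)^-1.
  have -> : complex.Re (-2%:R * \sum_k clog1m ((a k)^* * w)) =
      - (\sum_k complex.Re (clog1m ((a k)^* * w)) * 2%:R).
    rewrite -mulr_suml -(big_morph _ Re_add (erefl (complex.Re 0))).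
    by rewrite Re_mul/=; ring.
  rewrite expRN expR_sum; congr _^-1; apply: eq_bigr => k _.
  by rewrite expRM_natr expR_Re_clog1m ?AE// normcM normc_conj w1 mulr1.
rewrite !normcM normcX w1 expr1n mul1r !normc_real !gtr0_norm ?gpos//.
by rewrite mulrAC divff ?mul1r// gt_eqF.
Qed.

Lemma calA_poisson_mixture (t : R) K (a : 'I_K -> R[i]) (c : 'I_K -> R) : 0 < t ->
  (forall k, normc (a k) < 1) -> (forall k, 0 <= c k) -> \sum_k c k = 1 ->
  exists h, [/\ calA t K h, bddC h & forall w, normc w = 1 ->
    normc (h w) `^ t = \sum_k c k * poisson (a k) w].
Proof.
move=> t0 a1 c0 c1; have [f hf fE] := poisson_mixture_log a1 c0 c1.
have hft : disc_alg (fun z => (t^-1)%:C * f z) by exact: disc_algM (disc_alg_cst _) hf.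
exists (fun z => cexp ((t^-1)%:C * f z)).
have hE w : normc w = 1 -> normc (cexp ((t^-1)%:C * f w)) `^ t = \sum_k c k * poisson (a k) w.
  move=> w1; rewrite normc_cexp -expRM Re_mul /= mul0r subr0 mulrAC mulVf ?mul1r ?fE//.
  by rewrite gt_eqF.
split=> //; last by apply: disc_alg_bddC; exact: disc_alg_cexp.
split; [exact/hardy_disc_alg/disc_alg_cexp|exact: outer_cexp|].
by exists a, c; split=> //; apply: aeW => x; rewrite hE// normc_circ.
Qed.

End OuterFunctions.

(** * Positive quadrature for Poisson integrals of trigonometric polynomials *)

Section Quadrature.
Context {R : realType}.
Implicit Types (z w c u v : R[i]).

Lemma circ_exprz (x : R) (n : int) : circ x ^ n = circ (n%:~R * x).
Proof.
case: n => n; first by rewrite -exprnP circX.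
rewrite NegzE -exprnN circX; set y := n.+1%:R * x.
have -> : (- n.+1%:Z)%:~R * x = - y by rewrite mulrNz mulNr.
rewrite circN.
have y0 : circ y != 0 by rewrite -normc_gt0 normc_circ.
by apply: (mulfI y0); rewrite divff// mulc_conj normc_circ expr1n.
Qed.

(** If the cosine of [x] is one, then the sine of [x / 2] vanishes. *)
Lemma circ_neq1 (x : R) : 0 < x < 2 * pi -> circ x != 1.
Proof.
move=> /andP[x0 x2]; apply/eqP => /(congr1 (@complex.Re R)) /=.
have -> : x = (x / 2) *+ 2 by rewrite -mulr_natr divfK.
rewrite cos_mulr2n => h.
have : 0 < sin (x / 2) by apply: sin_gt0_pi; rewrite ?divr_gt0//; lra.
move=> s0; have := cos2Dsin2 (x / 2); have : 0 < sin (x / 2) ^+ 2 by rewrite exprn_gt0.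
by move: h; rewrite -mulr_natr; lra.
Qed.

Lemma sum_circ_root (N : nat) (n : int) : (`|n| < N)%N ->
  \sum_(k < N) circ (n%:~R * (k%:R * (2 * pi / N%:R)) : R) = if n == 0 then N%:R else 0.
Proof.
move=> nN; have N0 : (0 < N)%N by exact: leq_ltn_trans nN.
case: eqVneq => [->|n0].
  transitivity (\sum_(k < N) (1 : R[i])); last by rewrite sumr_const card_ord.
  by apply: eq_bigr => k _; rewrite mul0r circ0.
have NR : N%:R != 0 :> R by rewrite pnatr_eq0 -lt0n.
set x : R[i] := circ (n%:~R * (2 * pi / N%:R)).
have xE (k : 'I_N) : circ (n%:~R * (k%:R * (2 * pi / N%:R))) = x ^+ k.
  by rewrite /x circX; congr circ; ring.
rewrite (eq_bigr _ (fun k _ => xE k)).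
have xN : x ^+ N = 1.
  rewrite /x circX mulrCA [N%:R * _]mulrC divfK//.
  have -> : n%:~R * (2 * pi) = (2 * pi : R) * n%:~R by rewrite mulrC.
  rewrite [_ * n%:~R]mulrC -circ_exprz.
  have -> : circ (2 * pi) = 1 :> R[i] by rewrite -[2 * pi]add0r circ_periodic circ0.
  by rewrite exp1rz.
have x1 : x != 1.
  have h (m : nat) : (0 < m)%N -> (m < N)%N -> circ (m%:R * (2 * pi / N%:R)) != 1 :> R[i].
    move=> m0 mN; apply: circ_neq1; have := pi_gt0 R => p0.
    have NP : 0 < N%:R :> R by rewrite ltr0n.
    apply/andP; split; first by rewrite mulr_gt0 ?ltr0n// divr_gt0// mulr_gt0.
    by rewrite mulrA ltr_pdivrMr// mulrC ltr_pM2l ?mulr_gt0// ltr_nat.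
  rewrite /x; case: n n0 nN {xE xN x} => m /= n0 nN.
    by apply: h => //; rewrite lt0n; move: n0; apply: contra => /eqP ->.
  rewrite NegzE mulrNz mulNr circN; apply/eqP => /(congr1 conjc).
  rewrite conjcK rmorph1 => /eqP; apply/negP; exact: h.
have := subrX1 x N; rewrite xN subrr => /esym/eqP; rewrite mulf_eq0 subr_eq0 (negbTE x1)/=.
by move/eqP.
Qed.

Lemma exprz_Negz_circle v m : normc v = 1 -> v ^ Negz m = (v ^+ m.+1)^*.
Proof.
move=> v1; rewrite NegzE -exprnN.
have v0 : v ^+ m.+1 != 0 by rewrite -normc_gt0 normcX v1 expr1n.
by apply: (mulfI v0); rewrite divff// mulc_conj normcX v1 !expr1n.
Qed.

Lemma bddC_exprz (n : int) : bddC (fun v : R[i] => v ^ n).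
Proof.
case: n => m; first exact: (bddCX m bddC_id).
apply: (@eq_bddC _ (fun v => (v ^+ m.+1)^*)).
  by move=> v v1; rewrite exprz_Negz_circle.
by apply: bddCJ; exact: bddCX bddC_id.
Qed.

Lemma intT_poisson_exprz (r : R) w (n : int) : 0 <= r < 1 -> normc w = 1 ->
  intT (fun v => (poisson (r%:C * w) v)%:C * v ^ n) = (r ^+ `|n|)%:C * w ^ n.
Proof.
move=> /andP[r0 r1] w1.
have z1 : normc (r%:C * w) < 1 by rewrite normcM normc_real w1 mulr1 ger0_norm.
have bP : bddC (fun v => (poisson (r%:C * w) v)%:C).
  by apply: bddC_real; exact: bddT_poisson.
have hX m : intT (fun v => (poisson (r%:C * w) v)%:C * v ^+ m) = (r ^+ m)%:C * w ^+ m.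
  have := intT_poisson_poly 'X^m z1; rewrite hornerXn exprMn -rmorphXn/= => <-.
  by apply: eq_intT => v _; rewrite hornerXn.
case: n => m; first by rewrite -exprnP -hX; apply: eq_intT => v _; rewrite -exprnP.
rewrite exprz_Negz_circle//= -[LHS]conjcK -intTJ.
  rewrite (eq_intT (g := fun v => (poisson (r%:C * w) v)%:C * v ^+ m.+1)).
    by rewrite hX conjcM conjc_real.
  by move=> v v1; rewrite exprz_Negz_circle// conjcM conjcK conjc_real.
by apply: bddCM => //; exact: bddC_exprz.
Qed.

(** The node [k] is the [2d]-th root of unity [x = exp (i k pi / d)], and [b k] is
    the discrete Fourier coefficient of the sequence [r ^ |n|], [-d <= n < d]. Two
    geometric sums give the closed form
    [(1 - (-1) ^ k r ^ d) (1 - r ^ 2) / (2 d |1 - r x| ^ 2)], visibly nonnegative. *)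
Lemma poisson_quadrature (r : R) (d : nat) : 0 <= r < 1 -> (0 < d)%N ->
  exists b : 'I_(2 * d) -> R, [/\ forall k, 0 <= b k,
    forall k : 'I_(2 * d), k = 0%N :> nat -> r ^+ d <= b k &
    forall n : int, (`|n| < d)%N ->
      \sum_k (b k)%:C * circ (n%:~R * (k%:R * (2 * pi / (2 * d)%:R))) =
      (r ^+ `|n|)%:C].
Proof.
move=> /andP[r0 r1] d0; set N := (2 * d)%N; set theta := 2 * pi / N%:R.
have dR : 0 < d%:R :> R by rewrite ltr0n.
have NR : 0 < N%:R :> R by rewrite ltr0n muln_gt0.
have NC : N%:R != 0 :> R[i] by rewrite pnatr_eq0 -lt0n muln_gt0.
pose x (k : 'I_N) : R[i] := circ (k%:R * theta).
pose u k := r%:C * x k.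
have nu k : normc (u k) = r by rewrite normcM normc_real normc_circ mulr1 ger0_norm.
have u1 k : normc (u k) < 1 by rewrite nu.
have u10 k : 1 - u k != 0 by exact: oneB_neq0.
have uJ10 k : 1 - (u k)^* != 0 by rewrite oneB_neq0// normc_conj.
(* The nodes satisfy [x ^ d = +1] or [-1], alternately; this makes the geometric sums real. *)
have xd k : x k ^+ d = ((-1) ^+ k : R)%:C.
  rewrite /x circX mulrCA.
  have -> : d%:R * theta = pi.
    by rewrite /theta /N natrM; field; rewrite gt_eqF.
  rewrite -circX rmorphXn; congr (_ ^+ _).
  by rewrite /circ cospi sinpi; apply: complex_eqP; rewrite /= ?oppr0.
pose s k : R := r ^+ d * (-1) ^+ k.
have ud k : u k ^+ d = (s k)%:C by rewrite /u exprMn xd -rmorphXn /s rmorphM.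
have uJd k : (u k)^* ^+ d = (s k)%:C.
  by rewrite -conjcX ud conjc_real.
pose b (k : 'I_N) : R := N%:R^-1 * ((1 - s k) * (1 - r ^+ 2) / normc (1 - u k) ^+ 2).
have geo (v : R[i]) : normc v < 1 -> \sum_(j < d) v ^+ j = (1 - v ^+ d) / (1 - v).
  by move=> v1; rewrite mulrBl mul1r -(sub_geometric d v1) opprB addrC subrK.
have bE k : (b k)%:C = N%:R^-1 * (\sum_(j < d) u k ^+ j.+1 + \sum_(j < d) (u k)^* ^+ j).
  rewrite /b real_complexM real_complexV rmorph_nat; congr (_ * _).
  under eq_bigr do rewrite exprS.
  rewrite -mulr_sumr !geo ?normc_conj// ud uJd.
  move: (s k) => S.
  have -> : (1 - S) * (1 - r ^+ 2) / normc (1 - u k) ^+ 2 =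
     (1 - S) * ((1 - r ^+ 2) / normc (1 - u k) ^+ 2) by rewrite mulrA.
  rewrite real_complexM real_complexB real_complexM real_complexV real_complexB rmorph1 -mulc_conj.
  rewrite -{1}(nu k) -mulc_conj.
  have -> : (1 - u k)^* = 1 - (u k)^* by rewrite rmorphB rmorph1.
  move: (u k) (u k)^* S%:C (u10 k) (uJ10 k) => a a' S' h1 h2.
  by field; rewrite h1 h2.
exists b; split.
- move=> k; rewrite /b mulr_ge0 ?invr_ge0 ?(ltW NR)// divr_ge0 ?sqr_ge0// mulr_ge0//.
    rewrite subr_ge0 (le_trans (ler_norm _))// normrM !normrX normrN1 expr1n mulr1.
    by rewrite ger0_norm// exprn_ile1// ltW.
  by rewrite subr_ge0 exprn_ile1// ltW.
- move=> k k0; rewrite /b /s k0 expr0 mulr1.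
  have -> : normc (1 - u k) = 1 - r.
    rewrite /u /x k0 mul0r circ0 mulr1 -(rmorph1 (real_complex R)) -rmorphB normc_real.
    by rewrite ger0_norm// subr_ge0 ltW.
  have -> : (1 - r ^+ d) = (1 - r) * \sum_(j < d) r ^+ j.
    by rewrite -opprB subrX1 -mulNr opprB.
  have hs : d%:R * r ^+ d.-1 <= \sum_(j < d) r ^+ j.
    have -> : d%:R * r ^+ d.-1 = \sum_(j < d) r ^+ d.-1 by rewrite sumr_const card_ord mulr_natl.
    apply: ler_sum => j _; apply: ler_wiXn2l => //; first exact: ltW.
    by rewrite -ltnS prednK.
  rewrite -{1}(prednK d0) exprS /N natrM; move: hs.
  have : 0 <= r ^+ d.-1 by rewrite exprn_ge0.
  move: (r ^+ d.-1) (\sum_(j < d) r ^+ j) => y S y0 hs.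
  have r10 : 1 - r != 0 by rewrite subr_eq0 gt_eqF.
  have -> : (2 * d%:R)^-1 * ((1 - r) * S * (1 - r ^+ 2) / (1 - r) ^+ 2) =
     (1 + r) * S / (2 * d%:R).
    by field; rewrite gt_eqF.
  rewrite ler_pdivlMr; last by rewrite mulr_gt0.
  have S0 : 0 <= S by rewrite (le_trans _ hs)// mulr_ge0.
  have t1 : r * (d%:R * y) <= r * S by rewrite ler_wpM2l.
  have t2 : r * S <= S by rewrite ler_piMl// ltW.
  lra.
- move=> n nd.
  pose E (a : int) : R[i] := if a == 0 then N%:R else 0.
  have EE (a : int) : (`|a| < N)%N -> \sum_(k < N) circ (a%:~R * (k%:R * theta)) = E a.
    by move=> aN; rewrite /theta sum_circ_root.
  transitivity (N%:R^-1 * (\sum_(j < d) (r ^+ j.+1)%:C * E (n + j.+1%:Z)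
      + \sum_(j < d) (r ^+ j)%:C * E (n - j%:Z))).
    under eq_bigr do rewrite bE -mulrA mulrDl.
    rewrite -mulr_sumr big_split; congr (_ * (_ + _)).
      under eq_bigr do rewrite mulr_suml.
      rewrite exchange_big; apply: eq_bigr => j _.
      rewrite -EE; last first.
        by have := ltn_ord j; rewrite /N; lia.
      rewrite mulr_sumr; apply: eq_bigr => k _.
      rewrite /u exprMn -rmorphXn -mulrA; congr (_ * _).
      rewrite /x circX -circD; congr circ; rewrite intrD/=; ring.
    under eq_bigr do rewrite mulr_suml.
    rewrite exchange_big; apply: eq_bigr => j _.
    rewrite -EE; last first.
      by have := ltn_ord j; rewrite /N; lia.
    rewrite mulr_sumr; apply: eq_bigr => k _.
    rewrite /u conjcM conjc_real exprMn -rmorphXn -mulrA; congr (_ * _).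
    rewrite /x -circN circX -circD; congr circ; rewrite intrB/=; ring.
  case: n nd => m /= md.
  + rewrite big1 ?add0r => [|j _]; last by rewrite /E ifF ?mulr0//; apply/eqP; lia.
    rewrite (bigD1 (Ordinal md))//= big1 ?addr0 => [|j jm].
      by rewrite /E subrr eqxx mulrCA mulVf ?mulr1.
    rewrite /E ifF ?mulr0//; apply/eqP => h; move/eqP: jm; apply; apply: val_inj => /=; lia.
  + rewrite addrC big1 ?add0r => [|j _]; last by rewrite /E ifF ?mulr0//; apply/eqP; lia.
    have md' : (m < d)%N by lia.
    rewrite (bigD1 (Ordinal md'))//= big1 ?addr0 => [|j jm].
      have -> : Negz m + m.+1%:Z = 0 by rewrite NegzE addNr.
      by rewrite /E eqxx mulrCA mulVf ?mulr1.
    rewrite /E ifF ?mulr0//; apply/eqP => h; move/eqP: jm; apply; apply: val_inj => /=; lia.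
Qed.

(** The Poisson integral of [W] is a positive combination of values of [W] at [2 (D + 1)]
    points, one of which is [w] itself; the other terms are dropped. *)
Lemma poisson_mean_trig_ge (D : nat) (W : R[i] -> R) (r : R) w :
  trig_deg_le D (fun v => (W v)%:C) -> bddT W -> (forall v, normc v = 1 -> 0 <= W v) ->
  0 <= r < 1 -> normc w = 1 ->
  r ^+ D.+1 * W w <= meanT (fun v => W v * poisson (r%:C * w) v).
Proof.
move=> [c cE] bW W0 r01 w1.
have z1 : normc (r%:C * w) < 1.
  by move/andP: r01 => [? ?]; rewrite normcM normc_real w1 mulr1 ger0_norm.
have [b [b0 bd bE]] := poisson_quadrature r01 (ltn0Sn D).
pose om (k : 'I_(2 * D.+1)) : R[i] := circ (k%:R * (2 * pi / (2 * D.+1)%:R)).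
have w0 : w != 0 by rewrite -normc_gt0 w1.
have om1 k : normc (om k) = 1 by exact: normc_circ.
have om0 k : om k != 0 by rewrite -normc_gt0 om1.
have key : meanT (fun v => W v * poisson (r%:C * w) v) = \sum_k b k * W (om k * w).
  apply: (@complexI R); rewrite -intT_real rmorph_sum/=.
  transitivity (intT (fun v => \sum_i c i * ((poisson (r%:C * w) v)%:C * v ^ (i%:Z - D%:Z)))).
    apply: eq_intT => v v1; rewrite rmorphM/= cE// mulr_suml.
    by apply: eq_bigr => i _; ring.
  have bF i : bddC (fun v => (poisson (r%:C * w) v)%:C * v ^ (i%:Z - D%:Z)).
    apply: bddCM; last exact: bddC_exprz.
    by apply: bddC_real; exact: bddT_poisson.
  rewrite intT_sum; last by move=> i; apply: bddCM => //; exact: bddC_cst.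
  transitivity (\sum_i c i * ((r ^+ `|i%:Z - D%:Z|)%:C * w ^ (i%:Z - D%:Z))).
    by apply: eq_bigr => i _; rewrite intTZ// intT_poisson_exprz.
  transitivity (\sum_k (b k)%:C * \sum_i c i * (om k * w) ^ (i%:Z - D%:Z)); last first.
    by apply: eq_bigr => k _; rewrite rmorphM/= cE// normcM om1 w1 mulr1.
  under [RHS]eq_bigr do rewrite mulr_sumr.
  rewrite exchange_big/=; apply: eq_bigr => i _.
  rewrite -bE; last by have := ltn_ord i; lia.
  rewrite mulr_suml mulr_sumr; apply: eq_bigr => k _.
  rewrite expfzMl -circ_exprz -/(om k); ring.
rewrite key.
have k0 : (0 < 2 * D.+1)%N by [].
rewrite (bigD1 (Ordinal k0))//= {1}/om mul0r circ0 mul1r ler_wpDr//.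
  apply: sumr_ge0 => k _; rewrite mulr_ge0// W0// normcM om1 w1 mulr1//.
by rewrite ler_wpM2r ?W0// bd.
Qed.

End Quadrature.

(** * Finite Hoelder inequality, and sums of equally spaced Poisson kernels *)

Section Hoelder.
Context {R : realType}.

Lemma div_powR (u v e : R) : 0 <= u -> 0 < v -> (u / v) `^ e = u `^ e / v `^ e.
Proof.
move=> u0 v0; rewrite powRM// ?invr_ge0 ?ltW//; congr (_ * _).
by rewrite -(powR_inv1 (ltW v0)) -powRrM mulN1r powRN.
Qed.

Lemma powRVK (x e : R) : 0 <= x -> 0 < e -> (x `^ e^-1) `^ e = x.
Proof. by move=> x0 e0; rewrite -powRrM mulVf ?gt_eqF// powRr1. Qed.

(** Weighted, and with bounds [A], [B] in place of the norms: the weights are the values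
    of Poisson kernels at a point in one use and all equal to one in the other. *)
Lemma finite_hoelder (I : finType) (p x y : I -> R) (a b A B : R) :
  (forall i, 0 <= p i) -> (forall i, 0 <= x i) -> (forall i, 0 <= y i) ->
  0 < a -> 0 < b -> a^-1 + b^-1 = 1 -> 0 <= A -> 0 <= B ->
  \sum_i p i * x i `^ a <= A `^ a -> \sum_i p i * y i `^ b <= B `^ b ->
  \sum_i p i * (x i * y i) <= A * B.
Proof.
move=> p0 x0 y0 a0 b0 ab.
have null (f : I -> R) (e : R) : (forall i, 0 <= f i) -> 0 < e ->
    \sum_i p i * f i `^ e <= 0 `^ e -> forall i, p i * f i = 0.
  move=> f0 e0; rewrite powR0 ?gt_eqF// => h i.
  have : p i * f i `^ e = 0.
    apply/eqP; rewrite eq_le mulr_ge0 ?powR_ge0// andbT (le_trans _ h)//.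
    rewrite (bigD1 i)//= lerDl; apply: sumr_ge0 => j _.
    by rewrite mulr_ge0 ?powR_ge0.
  move/eqP; rewrite mulf_eq0 powR_eq0 => /orP[/eqP ->|/andP[/eqP -> _]].
    by rewrite mul0r.
  by rewrite mulr0.
rewrite le_eqVlt => /predU1P[<- B0 hx _|A0].
  rewrite big1 ?mul0r// => i _; by rewrite mulrA (null x a x0 a0 hx) ?mul0r.
rewrite le_eqVlt => /predU1P[<- _ hy|B0 hx hy].
  rewrite big1 ?mulr0// => i _; by rewrite mulrCA (null y b y0 b0 hy) mulr0.
have young i : p i * (x i * y i) <=
    A * B * (p i * x i `^ a / (a * A `^ a) + p i * y i `^ b / (b * B `^ b)).
  have := @conjugate_powR R (x i / A) (y i / B) a b.
  rewrite !divr_ge0 ?(ltW A0) ?(ltW B0)// => /(_ isT isT a0 b0 ab).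
  rewrite !div_powR// => h.
  have -> : p i * (x i * y i) = A * B * p i * (x i / A * (y i / B)).
    by field; rewrite !gt_eqF.
  rewrite (le_trans (ler_wpM2l _ h)) ?mulr_ge0 ?(ltW A0) ?(ltW B0)//.
  rewrite le_eqVlt; apply/orP; left; apply/eqP.
  by field; rewrite !gt_eqF ?powR_gt0.
rewrite (le_trans (ler_sum _ (fun i _ => young i)))//.
rewrite -mulr_sumr big_split/= -!mulr_suml ler_piMr ?mulr_ge0 ?(ltW A0) ?(ltW B0)//.
have Aa : 0 < A `^ a by rewrite powR_gt0.
have Bb : 0 < B `^ b by rewrite powR_gt0.
rewrite -ab lerD// ler_pdivrMr ?mulr_gt0// mulrA mulVf ?mul1r// gt_eqF//.
Qed.

Lemma poisson_le (z w : R[i]) : normc z < 1 -> normc w = 1 ->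
  poisson z w <= (1 + normc z) / (1 - normc z).
Proof.
move=> z1 w1; have z0 := normc_ge0 z.
have h : 1 - normc z <= normc (1 - z^* * w).
  by rewrite (le_trans _ (normc_1B_ge _))// normcM normc_conj w1 mulr1.
have -> : (1 + normc z) / (1 - normc z) = (1 - normc z ^+ 2) / (1 - normc z) ^+ 2.
  by field; rewrite subr_eq0 gt_eqF.
rewrite /poisson ler_wpM2l ?subr_ge0 ?exprn_ile1 ?(ltW z1)//.
rewrite lef_pV2 ?posrE ?exprn_gt0 ?subr_gt0//; last by rewrite (lt_le_trans _ h)// subr_gt0.
by rewrite lerXn2r ?nnegrE ?subr_ge0 ?(ltW z1)// normc_ge0.
Qed.

(** The [K]-th roots of unity, as rotations. *)
Definition rootT (K : nat) (k : 'I_K) : R[i] := circ (k%:R * (2 * pi / K%:R)).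

(** In the geometric series of the Cauchy kernel, summing over the roots of unity
    kills all powers but the multiples of [K]; what remains is the kernel at the [K]-th
    power of the point. *)
Lemma sum_poisson_roots (K : nat) (r : R) (v w : R[i]) : (0 < K)%N -> 0 <= r < 1 ->
  normc v = 1 -> normc w = 1 ->
  \sum_(k < K) poisson (r%:C * (rootT k * v)) w =
    K%:R * poisson ((r%:C * (v * w^*)) ^+ K) 1.
Proof.
move=> K0 /andP[r0 r1] v1 w1; set u := r%:C * (v * w^*).
have nu : normc u = r.
  by rewrite !normcM normc_conj v1 w1 normc_real !mulr1 ger0_norm.
have uK1 : normc (u ^+ K) < 1.
  by rewrite normcX nu exprn_ilt1 ?gtn_eqF.
have root1 k : normc (@rootT K k) = 1 by exact: normc_circ.
have a1 k : normc (r%:C * (@rootT K k * v)) < 1.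
  by rewrite !normcM v1 root1 normc_real !mulr1 ger0_norm.
have KC : K%:R != 0 :> R by rewrite pnatr_eq0 -lt0n.
have rootK k : (@rootT K k) ^+ K = 1.
  rewrite /rootT circX mulrCA mulrC [K%:R * _]mulrC divfK//.
  by rewrite mulrC -circX -[2 * pi]add0r circ_periodic circ0 expr1n.
have cauchy_sum : \sum_(k < K) cauchyk (r%:C * (rootT k * v)) w = K%:R * cauchyk (u ^+ K) 1.
  have uk0 : 1 - u ^+ K != 0 by exact: oneB_neq0.
  have term k : cauchyk (r%:C * (@rootT K k * v)) w = (1 - u ^+ K)^-1 * \sum_(j < K) (u * rootT k) ^+ j.
    have -> : cauchyk (r%:C * (@rootT K k * v)) w = (1 - u * rootT k)^-1.
      by rewrite /cauchyk /u; congr _^-1; ring.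
    have uk1 : normc (u * rootT k) < 1 by rewrite normcM root1 mulr1 nu.
    have := sub_geometric K uk1; rewrite exprMn rootK mulr1 => h.
    have -> : \sum_(j < K) (u * rootT k) ^+ j = (1 - u ^+ K) * (1 - u * rootT k)^-1.
      by rewrite mulrBl mul1r -h opprB addrC subrK.
    by rewrite mulrA mulVf// mul1r.
  rewrite (eq_bigr _ (fun k _ => term k)) -mulr_sumr exchange_big mulrC; congr (_ * _).
    rewrite (bigD1 (Ordinal K0))//= [X in X + _](eq_bigr (fun=> 1)); last by move=> k _; rewrite expr0.
    rewrite sumr_const card_ord big1 ?addr0// => j j0.
    have jn0 : j%:Z != 0.
      by apply: contra j0 => /eqP [j0]; apply/eqP/val_inj.
    have := @sum_circ_root R K j%:Z (ltn_ord j); rewrite (negbTE jn0) => h.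
    transitivity (\sum_(k < K) u ^+ j * circ (j%:~R * (k%:R * (2 * pi / K%:R)))).
      by apply: eq_bigr => k _; rewrite exprMn /rootT circX.
    by rewrite -mulr_sumr h mulr0.
  by rewrite /cauchyk conjc1 mulr1.
apply: (@complexI R); rewrite rmorph_sum real_complexM rmorph_nat poissonE ?normc1//.
rewrite (eq_bigr _ (fun k _ => poissonE (a1 k) w1)) sumrB big_split/=.
rewrite cauchy_sum sumr_const card_ord !mulrDr mulrN mulr1; congr (_ + _ - _).
have -> : \sum_(k < K) (cauchyk (r%:C * (rootT k * v)) w)^* =
   (\sum_(k < K) cauchyk (r%:C * (rootT k * v)) w)^*.
  by rewrite [RHS](rmorph_sum (@conjc R)).
by rewrite cauchy_sum conjcM conjc_nat.
Qed.

End Hoelder.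

(** * Equally spaced Poisson kernels as competitors *)

Section LowerBound.
Context {R : realType}.
Variables (s q : R).
Hypotheses (s0 : 0 < s) (q0 : 0 < q) (sq : s^-1 + q^-1 = 1).

(** The [K] Poisson kernels sit at radius [r] over rotated roots of unity and carry
    masses proportional to [W ^ q] at these directions. By Hoelder over the kernels, [|h| ^ 2]
    dominates the combination of the kernels with the masses to the power [1/s]; integrating
    against [W] brings in the Poisson integrals of [W], which are at least [r ^ (D + 1)] times
    the values of [W]. The sum of the kernels enters through its maximum
    [K (1 + r ^ K) / (1 - r ^ K)]. *)
Lemma calA_lower_bound (K D : nat) (r tau : R) (W : R[i] -> R) : (0 < K)%N -> 0 <= r < 1 ->
  trig_deg_le D (fun v => (W v)%:C) -> bddT W -> (forall v, normc v = 1 -> 0 <= W v) ->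
  exists h, [/\ calA (2 * s) K h, bddC h &
    r ^+ D.+1 * ((1 - r ^+ K) / (1 + r ^+ K)) `^ q^-1 *
      (K%:R^-1 * \sum_(k < K) W (rootT k * circ tau) `^ q) `^ q^-1
    <= meanT (fun v => W v * normc (h v) ^+ 2)].
Proof.
move=> K0 r01 tW bW W0; have /andP[r0 r1] := r01.
have KR : 0 < K%:R :> R by rewrite ltr0n.
pose v k := @rootT R K k * circ tau.
have v1 k : normc (v k) = 1 by rewrite normcM !normc_circ mulr1.
pose a k := r%:C * v k.
have a1 k : normc (a k) < 1 by rewrite normcM v1 mulr1 normc_real ger0_norm.
pose T := \sum_k W (v k) `^ q.
have T0 : 0 <= T by apply: sumr_ge0 => k _; exact: powR_ge0.
pose c k := if T == 0 then K%:R^-1 else W (v k) `^ q / T.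
have c0 k : 0 <= c k.
  by rewrite /c; case: ifP => _; [rewrite invr_ge0 ltW|rewrite divr_ge0// powR_ge0].
have c1 : \sum_k c k = 1.
  have [Tz|Tz] := eqVneq T 0.
    rewrite (eq_bigr (fun=> K%:R^-1)) => [|k _]; last by rewrite /c Tz eqxx.
    by rewrite sumr_const card_ord -[RHS](mulVf (lt0r_neq0 KR)) mulr_natr.
  rewrite (eq_bigr (fun k => W (v k) `^ q / T)) => [|k _]; last by rewrite /c (negbTE Tz).
  by rewrite -mulr_suml divff.
have ts0 : 0 < 2 * s by rewrite mulr_gt0.
have [h [hA bh hE]] := calA_poisson_mixture ts0 a1 c0 c1.
exists h; split=> //.
have bWh : bddT (fun w => W w * normc (h w) ^+ 2).
  apply: bddTM => //; apply: (eq_bddT (u := fun w => normc (h w) * normc (h w))).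
    by move=> w _; rewrite expr2.
  by apply: bddTM; exact: bddC_normc.
(* If [W] vanishes at all the nodes, the uniform masses do and the claim is [0 <= _]. *)
have [Tz|Tn0] := eqVneq T 0.
  rewrite -/T Tz mulr0 powR0 ?mulr0 ?gt_eqF ?invr_gt0//.
  by apply: meanT_ge0 => w w1; rewrite mulr_ge0 ?W0// sqr_ge0.
have Tpos : 0 < T by rewrite lt_neqAle eq_sym Tn0.
set rho := r ^+ K.
have rho0 : 0 <= rho by rewrite exprn_ge0.
have rho1 : rho < 1 by rewrite exprn_ilt1 ?gtn_eqF.
pose S := K%:R * ((1 + rho) / (1 - rho)).
have S0 : 0 < S by rewrite mulr_gt0// divr_gt0 ?subr_gt0// ltr_wpDr.
have h2 w : normc w = 1 -> normc (h w) ^+ 2 = (\sum_k c k * poisson (a k) w) `^ s^-1.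
  move=> w1; rewrite -hE// -powRrM mulfK ?gt_eqF//.
  by rewrite powR_mulrn// normc_ge0.
pose y k := c k `^ s^-1.
have pointwise w : normc w = 1 ->
    \sum_k poisson (a k) w * y k <= S `^ q^-1 * normc (h w) ^+ 2.
  move=> w1; rewrite h2//.
  rewrite (eq_bigr (fun k => poisson (a k) w * (1 * y k))) => [|k _]; last by rewrite mul1r.
  apply: (@finite_hoelder R 'I_K (fun k => poisson (a k) w) (fun=> 1) y q s) => //;
    rewrite ?powR_ge0//.
  - by move=> k; exact: poisson_ge0.
  - by move=> k; exact: powR_ge0.
  - by rewrite addrC.
  - rewrite -powRrM mulVf ?gt_eqF// powRr1 ?(ltW S0)//.
    rewrite (eq_bigr (fun k => poisson (a k) w)) => [|k _]; last by rewrite powR1 mulr1.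
    rewrite sum_poisson_roots ?normc_circ// /S ler_wpM2l ?(ltW KR)//.
    have e : normc ((r%:C * (circ tau * w^*)) ^+ K) = rho.
      by rewrite normcX !normcM normc_conj normc_circ w1 normc_real !mulr1 ger0_norm.
    rewrite -e poisson_le ?normc1//.
    by rewrite e.
  - rewrite -powRrM mulVf ?gt_eqF// powRr1; last first.
      by apply: sumr_ge0 => k _; rewrite mulr_ge0// poisson_ge0.
    apply: ler_sum => k _; rewrite /y -powRrM mulVf ?gt_eqF// powRr1//.
    by rewrite mulrC.
have bP k : bddT (fun w => W w * poisson (a k) w) by apply: bddTM => //; exact: bddT_poisson.
have int_lower : r ^+ D.+1 * \sum_k y k * W (v k) <=
    S `^ q^-1 * meanT (fun w => W w * normc (h w) ^+ 2).
  rewrite -meanTZ//.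
  rewrite (@le_trans _ _ (meanT (fun w => \sum_k y k * (W w * poisson (a k) w))))//.
    rewrite meanT_sum; last by move=> k; exact: bddTZ.
    rewrite mulr_sumr; apply: ler_sum => k _; rewrite meanTZ// mulrCA.
    by rewrite ler_wpM2l ?powR_ge0// poisson_mean_trig_ge.
  apply: le_meanT => [||w w1].
  - by apply: bddT_sum => k; exact: bddTZ.
  - exact: bddTZ.
  rewrite mulrCA (le_trans _ (ler_wpM2l (W0 _ w1) (pointwise w w1)))//.
  by rewrite mulr_sumr le_eqVlt; apply/orP; left; apply/eqP; apply: eq_bigr => k _; ring.
have sumy : \sum_k y k * W (v k) = T `^ q^-1.
  have -> : q^-1 = 1 - s^-1 by rewrite -sq addrC addKr.
  rewrite powRD; last by rewrite Tn0 implybT.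
  rewrite powRr1// powRN.
  have -> : T / T `^ s^-1 = \sum_k W (v k) `^ q / T `^ s^-1 by rewrite -mulr_suml.
  apply: eq_bigr => k _.
  rewrite /y /c (negbTE Tn0) div_powR ?powR_ge0// mulrAC; congr (_ / _).
  rewrite -powRrM -{2}(powRr1 (W0 _ (v1 k))) -powRD; last first.
    apply/implyP => /eqP e.
    have : 0 < q * s^-1 + 1 by rewrite addr_gt0// divr_gt0.
    by rewrite e ltxx.
  congr (_ `^ _); have : q * (s^-1 + q^-1) = q by rewrite sq mulr1.
  by rewrite mulrDr divff// gt_eqF.
rewrite sumy in int_lower.
have Sq : 0 < S `^ q^-1 by rewrite powR_gt0.
rewrite -(ler_pM2l Sq) (le_trans _ int_lower)// -/T.
rewrite le_eqVlt; apply/orP; left; apply/eqP.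
rewrite mulrCA -!mulrA; congr (_ * _).
rewrite -!powRM ?mulr_ge0 ?invr_ge0 ?(ltW KR) ?subr_ge0 ?(ltW rho1) ?addr_ge0 ?(ltW S0)//; congr (_ `^ _).
by rewrite /S -/rho; field; rewrite !gt_eqF//; lra.
Qed.

(** The average of [u] over a rotated set of roots of unity has, over all rotations,
    the same mean as [u]. *)
Lemma meanT_le_of_rotations (K : nat) (u : R[i] -> R) (B : R) : (0 < K)%N -> bddT u ->
  (forall tau : R, K%:R^-1 * \sum_(k < K) u (rootT k * circ tau) <= B) -> meanT u <= B.
Proof.
move=> K0 bu h; have KR : 0 < K%:R :> R by rewrite ltr0n.
have br k : bddT (fun w => u (w * @rootT R K k)) by exact: bddT_rot.
have -> : meanT u = meanT (fun w => K%:R^-1 * \sum_(k < K) u (w * rootT k)).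
  rewrite meanTZ; last exact: bddT_sum.
  rewrite meanT_sum// (eq_bigr (fun=> meanT u)) => [|k _].
    by rewrite sumr_const card_ord -[X in _ * X]mulr_natl mulrA mulVf ?mul1r// gt_eqF.
  apply: meanT_rot => //; apply/andP; split.
    by rewrite mulr_ge0// divr_ge0// ?mulr_ge0// ?ltW// pi_gt0.
  have -> : k%:R * (2 * pi / K%:R) = 2 * pi * (k%:R / K%:R) :> R by ring.
  rewrite ler_piMr ?mulr_ge0 ?(ltW (pi_gt0 R))//.
  by rewrite ler_pdivrMr// mul1r ler_nat ltnW.
rewrite -(meanT_cst B); apply: le_meanT.
- by apply: bddTZ; exact: bddT_sum.
- exact: bddT_cst.
move=> w /circ_onto[tau ->]; rewrite (le_trans _ (h tau))//.
apply: ler_wpM2l; first by rewrite invr_ge0 ltW.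
by apply: ler_sum => k _; rewrite mulrC.
Qed.

End LowerBound.

(** * Duality between the two norming constants *)

Section Duality.
Context {R : realType}.
Local Notation P := (haarT R).

Definition integrableT (u : R[i] -> R) : Prop :=
  P.-integrable [set: measurableTypeR R] (EFin \o (fun x : R => u (circ x))).

Lemma integrableT_mean (u : R[i] -> R) : integrableT u ->
  (\int[P]_x (u (circ x))%:E)%E = (meanT u)%:E.
Proof. by move=> iu; rewrite /meanT /Rintegral fineK//; exact: integrable_fin_num. Qed.

Lemma integrableT_hardy_norm (t : R) (h : R[i] -> R[i]) : 0 < t -> measT h ->
  (normT t h <= 1)%E ->
  integrableT (fun w => normc (h w) `^ t) /\ meanT (fun w => normc (h w) `^ t) <= 1.
Proof.
move=> t0 mh hn.
have mt : measurable_fun [set: measurableTypeR R] (fun x : R => normc (h (circ x)) `^ t).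
  exact: (measurableT_comp (measurable_powR _) (measT_normc mh)).
have I0 : (0 <= \int[P]_x (normc (h (circ x)) `^ t)%:E)%E.
  by apply: integral_ge0 => x _; rewrite lee_fin powR_ge0.
have I1 : (\int[P]_x (normc (h (circ x)) `^ t)%:E <= 1)%E.
  have : ((normT t h) `^ t <= 1 `^ t)%E.
    apply: gt0_ler_poweR => //; first exact: ltW.
      by rewrite in_itv/= Lnorm_ge0 leey.
    by rewrite in_itv/= lee01 leey.
  rewrite poweR1r normT_integralE -poweRrM mulVf ?gt_eqF// poweRe1//.
have it : integrableT (fun w => normc (h w) `^ t).
  apply/integrableP; split; first exact/measurable_EFinP.
  rewrite (le_lt_trans _ (ltry 1))// (le_trans _ I1)// le_eqVlt; apply/orP; left; apply/eqP.
  by apply: eq_integral => x _ /=; rewrite ger0_norm ?powR_ge0.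
by split=> //; rewrite -lee_fin -integrableT_mean.
Qed.

Lemma sqr_le_1powR (x t : R) : 0 <= x -> 2 <= t -> x ^+ 2 <= 1 + x `^ t.
Proof.
move=> x0 t2; have [x1|x1] := leP x 1.
  by rewrite (@le_trans _ _ 1)// ?exprn_ile1// lerDl powR_ge0.
rewrite -powR_mulrn// (@le_trans _ _ (x `^ t))//; last by rewrite lerDr.
by apply: ler_powR => //; exact: ltW.
Qed.

Lemma integrableT_weight (t : R) (W : R[i] -> R) (h : R[i] -> R[i]) (M : R) : 2 <= t ->
  bddT W -> (forall w, normc w = 1 -> 0 <= W w <= M) -> measT h -> (normT t h <= 1)%E ->
  integrableT (fun w => W w * normc (h w) ^+ 2) /\
  meanT (fun w => W w * normc (h w) ^+ 2) <= M * 2.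
Proof.
move=> t2 bW WM mh hn; have t0 : 0 < t by rewrite (lt_le_trans _ t2).
have [it mt] := integrableT_hardy_norm t0 mh hn.
have i1 : integrableT (fun=> 1) := bddT_integrable (bddT_cst 1).
have i2 : integrableT (fun w => M * (1 + normc (h w) `^ t)).
  have := integrableZl measurableT M (integrableD measurableT i1 it).
  by apply: eq_integrable => // x _ /=.
have M0 : 0 <= M by have /andP[a b] := WM 1 (normc1 R); exact: le_trans b.
have le_ w : normc w = 1 -> W w * normc (h w) ^+ 2 <= M * (1 + normc (h w) `^ t).
  move=> w1; have /andP[a b] := WM w w1.
  by apply: ler_pM; rewrite ?sqr_ge0// sqr_le_1powR ?normc_ge0.
have i3 : integrableT (fun w => W w * normc (h w) ^+ 2).
  apply: (le_integrable _ _ _ i2) => //.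
    apply/measurable_EFinP; apply: measurable_funM; first by case: bW.
    by apply: measurable_funX; exact: measT_normc.
  move=> x _ /=; rewrite lee_fin !ger0_norm ?le_ ?normc_circ//.
    by rewrite mulr_ge0// addr_ge0// powR_ge0.
  by rewrite mulr_ge0 ?sqr_ge0//; have /andP[] := WM _ (normc_circ x).
split=> //; rewrite (@le_trans _ _ (meanT (fun w => M * (1 + normc (h w) `^ t))))//.
  by apply: le_Rintegral => // x _; rewrite le_ ?normc_circ.
rewrite /meanT RintegralZl//; last first.
  by have := integrableD measurableT i1 it; apply: eq_integrable => // x _ /=.
rewrite RintegralD// ler_wpM2l//.
have -> : (2 : R) = 1 + 1 by ring.
by rewrite lerD//; rewrite -[X in X <= _]/(meanT (fun=> 1)) meanT_cst.
Qed.

(** Young's inequality, integrated. The constant [A] bounds the norm of [W] instead of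
    being equal to it, which avoids a separate treatment of norm zero. *)
Lemma hoelder_meanT (s q A : R) (W : R[i] -> R) (h : R[i] -> R[i]) :
  0 < s -> 0 < q -> s^-1 + q^-1 = 1 -> 1 <= s -> 0 < A ->
  bddT W -> (forall w, normc w = 1 -> 0 <= W w) ->
  meanT (fun w => W w `^ q) <= A `^ q -> measT h -> (normT (2 * s) h <= 1)%E ->
  meanT (fun w => W w * normc (h w) ^+ 2) <= A.
Proof.
move=> s0 q0 sq s1 A0 bW W0 hW mh hn.
have t2 : 2 <= 2 * s by rewrite ler_peMr.
have t0 : 0 < 2 * s by rewrite mulr_gt0.
have [M hM] : exists M : R, forall w, normc w = 1 -> 0 <= W w <= M.
  have [_ [M hM]] := bW; exists M => w w1; rewrite W0//=.
  by rewrite (le_trans (ler_norm _))// hM.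
have [iWh _] := integrableT_weight t2 bW hM mh hn.
have [it mt] := integrableT_hardy_norm t0 mh hn.
have bWq : bddT (fun w => W w `^ q).
  by apply: eq_bddT (bddT_powR bW (ltW q0)) => w w1; rewrite ger0_norm ?W0.
have iq : integrableT (fun w => W w `^ q) := bddT_integrable bWq.
have Aq : 0 < A `^ q by rewrite powR_gt0.
pose k1 := A / (q * A `^ q); pose k2 := A / s.
have k10 : 0 <= k1 by rewrite divr_ge0 ?mulr_ge0// ltW.
have k20 : 0 <= k2 by rewrite divr_ge0 ?mulr_ge0// ltW.
have i1 : integrableT (fun w => k1 * W w `^ q).
  by have := integrableZl measurableT k1 iq; apply: eq_integrable => // x _ /=.
have i2 : integrableT (fun w => k2 * normc (h w) `^ (2 * s)).
  by have := integrableZl measurableT k2 it; apply: eq_integrable => // x _ /=.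
have young w : normc w = 1 ->
    W w * normc (h w) ^+ 2 <= k1 * W w `^ q + k2 * normc (h w) `^ (2 * s).
  move=> w1; have w0 := W0 w w1.
  have := @conjugate_powR R (W w / A) (normc (h w) ^+ 2) q s.
  rewrite divr_ge0 ?(ltW A0)// sqr_ge0 [q^-1 + _]addrC => /(_ isT isT q0 s0 sq).
  rewrite div_powR// => H; have := ler_wpM2l (ltW A0) H.
  have -> : A * (W w / A * normc (h w) ^+ 2) = W w * normc (h w) ^+ 2.
    by field; rewrite gt_eqF.
  move=> /le_trans; apply; rewrite -powR_mulrn ?normc_ge0// -powRrM.
  rewrite le_eqVlt; apply/orP; left; apply/eqP.
  by rewrite /k1 /k2; field; rewrite !gt_eqF.
rewrite (@le_trans _ _ (meanT (fun w => k1 * W w `^ q + k2 * normc (h w) `^ (2 * s))))//.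
  apply: le_Rintegral => //.
    by have := integrableD measurableT i1 i2; apply: eq_integrable => // x _ /=.
  by move=> x _; rewrite young ?normc_circ.
rewrite /meanT RintegralD// RintegralZl// RintegralZl//.
rewrite (@le_trans _ _ (k1 * A `^ q + k2 * 1))//.
  by rewrite lerD// ler_wpM2l.
rewrite le_eqVlt; apply/orP; left; apply/eqP.
have -> : k1 * A `^ q + k2 * 1 = A * (s^-1 + q^-1).
  by rewrite /k1 /k2; field; rewrite !gt_eqF.
by rewrite sq mulr1.
Qed.

Section Family.
Variables (m : nat) (X : 'I_m -> {poly R[i]}).

Definition weight (j : 'I_m) (w : R[i]) : R := normc (X j).[w] ^+ 2.
(** The squared norm of [X j * h] in [L^2]. *)
Definition energy (j : 'I_m) (h : R[i] -> R[i]) : R :=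
  meanT (fun w => weight j w * normc (h w) ^+ 2).

Lemma weight_ge0 j w : 0 <= weight j w. Proof. exact: sqr_ge0. Qed.

Lemma bddT_weight j : bddT (weight j).
Proof.
apply: (eq_bddT (u := fun w => normc (X j).[w] * normc (X j).[w])).
  by move=> w _; rewrite /weight expr2.
by apply: bddTM; apply: bddC_normc; exact: bddC_poly.
Qed.

Lemma energy_ge0 j h : 0 <= energy j h.
Proof. by apply: meanT_ge0 => w _; rewrite mulr_ge0 ?sqr_ge0. Qed.

Lemma colnormE (s : R) (h : R[i] -> R[i]) : 0 < s ->
  (forall j, integrableT (fun w => weight j w * normc (h w) ^+ 2)) ->
  colnorm (2 * s) X h = ((\sum_j energy j h `^ s) `^ (2 * s)^-1)%:E.
Proof.
move=> s0 hi; rewrite /colnorm.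
rewrite (eq_bigr (fun j => (energy j h `^ s)%:E)) => [|j _]; first by rewrite sumEFin.
rewrite normT_integralE.
have -> : (\int[P]_x (normc ((X j).[circ x] * h (circ x)) `^ 2)%:E)%E = (energy j h)%:E.
  rewrite -integrableT_mean//; apply: eq_integral => x _; congr EFin.
  by rewrite powR_mulrn ?normc_ge0// normcM exprMn.
by rewrite !poweR_EFin -powRrM mulrA mulVf ?mul1r// pnatr_eq0.
Qed.

Definition wsum (lam : 'I_m -> R) (w : R[i]) : R := \sum_j lam j * weight j w.

Lemma bddT_wsum lam : bddT (wsum lam).
Proof. by apply: bddT_sum => j; apply: bddTZ; exact: bddT_weight. Qed.

Lemma trig_deg_wsum D lam :
  (forall j, trig_deg_le D (fun w => `|(X j).[w]| ^+ 2)) ->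
  trig_deg_le D (fun w => (wsum lam w)%:C).
Proof.
move=> /choice[c hc]; exists (fun k => \sum_j (lam j)%:C * c j k) => w w1.
rewrite /wsum rmorph_sum/=.
transitivity (\sum_j (lam j)%:C * \sum_k c j k * w ^ (k%:Z - D%:Z)).
  apply: eq_bigr => j _; rewrite real_complexM -hc// normc_Num -rmorphXn//.
under [LHS]eq_bigr do rewrite mulr_sumr.
rewrite exchange_big/=; apply: eq_bigr => k _; rewrite mulr_suml.
by apply: eq_bigr => j _; rewrite mulrA.
Qed.

Lemma energy_wsum lam h :
  (forall j, integrableT (fun w => weight j w * normc (h w) ^+ 2)) ->
  meanT (fun w => wsum lam w * normc (h w) ^+ 2) = \sum_j lam j * energy j h.
Proof.
move=> hi.
have iZ j : integrableT (fun w => lam j * (weight j w * normc (h w) ^+ 2)).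
  by have := integrableZl measurableT (lam j) (hi j); apply: eq_integrable => // x _ /=.
pose F (r : seq 'I_m) w := \sum_(j <- r) lam j * (weight j w * normc (h w) ^+ 2).
have H (r : seq 'I_m) : integrableT (F r) /\ meanT (F r) = \sum_(j <- r) lam j * energy j h.
  elim: r => [|j r [IH1 IH2]].
    have F0 : F [::] = fun=> 0 by apply/funext => w; rewrite /F big_nil.
    by rewrite F0 big_nil meanT_cst; split=> //; exact: bddT_integrable (bddT_cst 0).
  have Fc : F (j :: r) = fun w => lam j * (weight j w * normc (h w) ^+ 2) + F r w.
    by apply/funext => w; rewrite /F big_cons.
  rewrite Fc big_cons -IH2; split.
    by have := integrableD measurableT (iZ j) IH1; apply: eq_integrable => // x _ /=.
  rewrite /energy /meanT -RintegralZl//; last exact: hi.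
  apply: RintegralD => //; exact: (iZ j).
have [_ <-] := H (index_enum 'I_m).
by apply: eq_meanT => w _; rewrite /F /wsum mulr_suml; apply: eq_bigr => j _; rewrite mulrA.
Qed.

(** A fraction of the full squared norm that the competitors of radius [r] are sure to
    capture. *)
Definition kappa (q r : R) (K D : nat) : R :=
  r ^+ D.+1 * ((1 - r ^+ K) / (1 + r ^+ K)) `^ q^-1.

(** The coefficients [lam] are those for which Hoelder's inequality between [l^s] and
    [l^q] is an equality at the energies of [h]; they turn the squared norm at [h] into the
    integral of [W * |h| ^ 2]. The competitors built for [W] bound the averages of [W ^ q]
    over rotated roots of unity, hence the integral of [W ^ q], hence the integral of
    [W * |h| ^ 2]. *)
Lemma dual_bound (s q r B : R) (K D : nat) (h : R[i] -> R[i]) :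
  0 < s -> 0 < q -> s^-1 + q^-1 = 1 -> 1 <= s -> (0 < K)%N -> 0 <= r < 1 -> 0 <= B ->
  (forall j, trig_deg_le D (fun w => `|(X j).[w]| ^+ 2)) ->
  (forall h', calA (2 * s) K h' -> bddC h' -> (\sum_j energy j h' `^ s) `^ s^-1 <= B) ->
  measT h -> (normT (2 * s) h <= 1)%E ->
  kappa q r K D * (\sum_j energy j h `^ s) `^ s^-1 <= B.
Proof.
move=> s0 q0 sq s1 K0 r01 B0 tX hB mh hn.
set V := \sum_j _; have V0 : 0 <= V by apply: sumr_ge0 => j _; exact: powR_ge0.
have [Vz|Vn0] := eqVneq V 0.
  by rewrite Vz powR0 ?mulr0// gt_eqF// invr_gt0.
have Vpos : 0 < V by rewrite lt_neqAle eq_sym Vn0.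
have /andP[r0 r1] := r01.
have kap0 : 0 <= kappa q r K D by rewrite mulr_ge0 ?exprn_ge0 ?powR_ge0.
move: kap0; rewrite le_eqVlt => /predU1P[<-|kap0]; first by rewrite mul0r.
have t2 : 2 <= 2 * s by rewrite ler_peMr.
have hi j : integrableT (fun w => weight j w * normc (h w) ^+ 2).
  have [_ [M hM]] := bddT_weight j.
  have WM w : normc w = 1 -> 0 <= weight j w <= M.
    by move=> w1; rewrite weight_ge0/= (le_trans (ler_norm _))// hM.
  by have [] := @integrableT_weight _ (weight j) h M t2 (bddT_weight j) WM mh hn.
pose lam j := energy j h `^ (s - 1) / V `^ q^-1.
have lam0 j : 0 <= lam j by rewrite divr_ge0 ?powR_ge0.
have Vq : 0 < V `^ q^-1 by rewrite powR_gt0.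
have lam_q : \sum_j lam j `^ q = 1.
  rewrite (eq_bigr (fun j => energy j h `^ s / V)) => [|j _].
    by rewrite -mulr_suml divff.
  rewrite /lam div_powR ?powR_ge0// -!powRrM mulVf ?gt_eqF// powRr1//.
  congr (_ `^ _ / _).
  have : q * s * (s^-1 + q^-1) = q * s by rewrite sq mulr1.
  have -> : q * s * (s^-1 + q^-1) = q + s by field; rewrite !gt_eqF.
  by move=> e; rewrite mulrBl mul1r mulrC -e; ring.
have lamE : \sum_j lam j * energy j h = V `^ s^-1.
  have -> : s^-1 = 1 - q^-1 by rewrite -sq addrK.
  rewrite powRD; last by rewrite Vn0 implybT.
  rewrite powRr1// powRN.
  have -> : V / V `^ q^-1 = \sum_j energy j h `^ s / V `^ q^-1 by rewrite -mulr_suml.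
  apply: eq_bigr => j _; rewrite /lam mulrAC; congr (_ / _).
  rewrite -{2}(powRr1 (energy_ge0 j h)) -powRD ?subrK//.
  by apply/implyP; rewrite gt_eqF.
pose W := wsum lam.
have W0 w : 0 <= W w by apply: sumr_ge0 => j _; rewrite mulr_ge0 ?weight_ge0.
have bW : bddT W := bddT_wsum lam.
have tW := trig_deg_wsum lam tX.
have bWq : bddT (fun w => W w `^ q).
  by apply: eq_bddT (bddT_powR bW (ltW q0)) => w w1; rewrite ger0_norm ?W0.
(* The slack [e] makes the bound on the norm of [W] positive, as [hoelder_meanT] wants. *)
rewrite mulrC -ler_pdivlMr//; apply/ler_addgt0Pr => e e0.
set A := B / _ + e.
have A0 : 0 < A by rewrite ltr_wpDl// divr_ge0// ltW.
rewrite -lamE -energy_wsum//; apply: (hoelder_meanT s0 q0 sq) => //.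
apply: (meanT_le_of_rotations K0 bWq) => tau.
have [h' [h'A bh' lower]] := calA_lower_bound s0 q0 sq tau K0 r01 tW bW (fun w _ => W0 w).
have hi' j : integrableT (fun w => weight j w * normc (h' w) ^+ 2).
  apply: bddT_integrable; apply: bddTM; first exact: bddT_weight.
  apply: (eq_bddT (u := fun w => normc (h' w) * normc (h' w))).
    by move=> w _; rewrite expr2.
  by apply: bddTM; exact: bddC_normc.
have upper : \sum_j lam j * energy j h' <= B.
  rewrite -[leRHS]mul1r (le_trans _ (ler_wpM2l ler01 (hB h' h'A bh')))//.
  rewrite (eq_bigr (fun j => 1 * (lam j * energy j h'))) => [|j _]; last by rewrite mul1r.
  have h1 : \sum_(j < m) 1 * lam j `^ q <= 1 `^ q.
    by rewrite powR1 -[leRHS]lam_q; apply: ler_sum => j _; rewrite mul1r.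
  have h2 : \sum_(j < m) 1 * energy j h' `^ s <= ((\sum_j energy j h' `^ s) `^ s^-1) `^ s.
    have V'0 : 0 <= \sum_j energy j h' `^ s by apply: sumr_ge0 => j _; exact: powR_ge0.
    rewrite (powRVK V'0 s0); apply: ler_sum => j _; rewrite mul1r; exact: lexx.
  have qs : q^-1 + s^-1 = 1 by rewrite addrC.
  exact: (finite_hoelder (fun=> ler01) lam0 (fun j => energy_ge0 j h') q0 s0 qs
    ler01 (powR_ge0 _ _) h1 h2).
rewrite -energy_wsum// in upper.
have := le_trans lower upper; rewrite -/(kappa q r K D) mulrC -ler_pdivlMr// => hA.
set S := K%:R^-1 * _ in hA *.
have S0 : 0 <= S by rewrite mulr_ge0 ?invr_ge0// sumr_ge0// => k _; exact: powR_ge0.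
rewrite -(powRVK S0 q0).
apply: ge0_ler_powR; rewrite ?nnegrE ?powR_ge0 ?(ltW A0) ?(ltW q0)//.
by rewrite (le_trans hA)// lerDl ltW.
Qed.

End Family.
End Duality.

(** * The two constants as real numbers *)

Section Assemble.
Context {R : realType}.
Local Notation P := (haarT R).

Lemma meanT_poisson (z : R[i]) : normc z < 1 -> meanT (poisson z) = 1.
Proof.
move=> z1; apply: (@complexI R); rewrite -intT_real -[RHS](hornerC _ z).
rewrite -(intT_poisson_poly _ z1); apply: eq_intT => w _.
by rewrite hornerC mulr1.
Qed.

Lemma calA_norm_le1 (t : R) (K : nat) h : 0 < t -> calA t K h -> (normT t h <= 1)%E.
Proof.
move=> t0 [[mh _ _] _ [a [c [a1 c0 c1 hE]]]].
have bg : bddT (fun w => \sum_k c k * poisson (a k) w).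
  by apply: bddT_sum => k; apply: bddTZ; exact: bddT_poisson.
have mt : measurable_fun [set: measurableTypeR R] (fun x : R => normc (h (circ x)) `^ t).
  exact: (measurableT_comp (measurable_powR _) (measT_normc mh)).
rewrite normT_integralE.
have -> : (\int[P]_x (normc (h (circ x)) `^ t)%:E)%E = 1%E.
  have -> : 1%E = (meanT (fun w => \sum_k c k * poisson (a k) w))%:E.
    rewrite meanT_sum; last by move=> k; apply: bddTZ; exact: bddT_poisson.
    rewrite -c1; congr EFin; apply: eq_bigr => k _.
    by rewrite meanTZ ?meanT_poisson ?mulr1//; exact: bddT_poisson.
  rewrite -integrableT_mean; last exact: bddT_integrable.
  apply: ge0_ae_eq_integral => //.
  - exact/measurable_EFinP.
  - by apply/measurable_EFinP; case: bg.
  - by move=> x _; rewrite lee_fin powR_ge0.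
  - move=> x _; rewrite lee_fin; apply: sumr_ge0 => k _.
    by rewrite mulr_ge0// poisson_ge0.
  - case: hE => N [mN N0 hN]; exists N; split=> // x bad; apply: hN => hx.
    by apply: bad => _; rewrite /= hx.
by rewrite poweR1r.
Qed.

Section Family.
Variables (m : nat) (X : 'I_m -> {poly R[i]}) (s q : R).
Hypotheses (s1 : 1 <= s) (q0 : 0 < q) (sq : s^-1 + q^-1 = 1).

Let s0 : 0 < s. Proof. exact: lt_le_trans s1. Qed.
Let t0 : 0 < 2 * s. Proof. by rewrite mulr_gt0. Qed.
Let t2 : 2 <= 2 * s. Proof. by rewrite ler_peMr. Qed.

Lemma weight_bounds j : exists M : R, forall w, normc w = 1 -> 0 <= weight X j w <= M.
Proof.
have [_ [M hM]] := bddT_weight X j; exists M => w w1.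
by rewrite weight_ge0/= (le_trans (ler_norm _))// hM.
Qed.

Lemma colnorm_ball h : measT h -> (normT (2 * s) h <= 1)%E ->
  colnorm (2 * s) X h = ((\sum_j energy X j h `^ s) `^ (2 * s)^-1)%:E.
Proof.
move=> mh hn; apply: colnormE => // j; have [M hM] := weight_bounds j.
by have [] := integrableT_weight t2 (bddT_weight X j) hM mh hn.
Qed.

Lemma colnorm_ball_bounded : exists C : R, forall h, measT h ->
  (normT (2 * s) h <= 1)%E -> (colnorm (2 * s) X h <= C%:E)%E.
Proof.
have [M hM] := choice weight_bounds.
exists ((\sum_j (M j * 2) `^ s) `^ (2 * s)^-1) => h mh hn.
rewrite colnorm_ball// lee_fin.
have M0 j : 0 <= M j by have /andP[] := hM j 1 (normc1 R); exact: le_trans.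
apply: ge0_ler_powR; rewrite ?invr_ge0 ?(ltW t0)// ?nnegrE.
- by apply: sumr_ge0 => j _; exact: powR_ge0.
- by apply: sumr_ge0 => j _; exact: powR_ge0.
apply: ler_sum => j _; apply: ge0_ler_powR; rewrite ?(ltW s0)// ?nnegrE ?energy_ge0 ?mulr_ge0//.
by have [] := integrableT_weight t2 (bddT_weight X j) (hM j) mh hn.
Qed.

(** Finiteness and nonnegativity let the two suprema be treated as real numbers; then
    the bound for each [h] in the unit ball passes to the supremum. *)
Lemma scrC_ratio (K D : nat) : (0 < K)%N ->
  (forall j, trig_deg_le D (fun w => `|(X j).[w]| ^+ 2)) ->
  exists coo cK : R, [/\ scrC_oo (2 * s) X = coo%:E, scrC (2 * s) X K = cK%:E,
    0 <= cK <= coo & forall r : R, 0 <= r < 1 -> kappa q r K D * coo ^+ 2 <= cK ^+ 2].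
Proof.
move=> K0 tX; have [C hC] := colnorm_ball_bounded.
have ball_meas h : calA (2 * s) K h -> measT h by move=> [[]].
have sub_ball : (scrC (2 * s) X K <= scrC_oo (2 * s) X)%E.
  apply: ereal_sup_le => _ [h hA <-]; exists h => //; split; first by case: hA.
  exact: calA_norm_le1 hA.
have oo_le : (scrC_oo (2 * s) X <= C%:E)%E.
  by apply: ge_ereal_sup => _ [h [[mh _ _] hn] <-]; exact: hC.
have [h0 [h0A _ _]] : exists h, [/\ calA (2 * s) K h, bddC h &
    forall w, normc w = 1 -> normc (h w) `^ (2 * s) = \sum_(k < K) K%:R^-1 * poisson 0 w].
  apply: (calA_poisson_mixture (a := fun=> 0) (c := fun=> K%:R^-1)) => //.
    by move=> _; rewrite normc0 ltr01.
  by rewrite sumr_const card_ord -[LHS]mulr_natr mulVf// pnatr_eq0 -lt0n.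
have K_ge : (0 <= scrC (2 * s) X K)%E.
  apply: le_trans (ereal_sup_ubound (imageP _ h0A)).
  by rewrite (colnorm_ball (ball_meas _ h0A) (calA_norm_le1 t0 h0A)) lee_fin powR_ge0.
move: sub_ball oo_le K_ge (@ereal_sup_ubound R [set colnorm (2 * s) X h | h in calA (2 * s) K])
  (@ge_ereal_sup R [set colnorm (2 * s) X h | h in [set h | hardy (2 * s) h /\ (normT (2 * s) h <= 1)%E]]).
rewrite -/(scrC _ _ _) -/(scrC_oo _ _).
case: (scrC_oo _ _) => [coo| |]//; case: (scrC _ _ _) => [cK| |]//.
rewrite !lee_fin => cKoo _ cK0 ubK lub; exists coo, cK; split=> //.
  by rewrite cK0 cKoo.
move=> r r01.
have kap0 : 0 <= kappa q r K D.
  by have /andP[? ?] := r01; rewrite mulr_ge0 ?exprn_ge0 ?powR_ge0.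
move: kap0; rewrite le_eqVlt => /predU1P[<-|kap0]; first by rewrite mul0r sqr_ge0.
(* [colnorm] is the [t]-norm of a vector of [L^2] norms, [t = 2 s]; its square is an [s]-norm. *)
have sqrt_half (V : R) : 0 <= V -> (V `^ (2 * s)^-1) ^+ 2 = V `^ s^-1.
  move=> V0; rewrite -powR_mulrn ?powR_ge0// -powRrM; congr (_ `^ _).
  by field; rewrite gt_eqF.
have sum0 h : 0 <= \sum_j energy X j h `^ s by apply: sumr_ge0 => j _; exact: powR_ge0.
have hB h : calA (2 * s) K h -> bddC h -> (\sum_j energy X j h `^ s) `^ s^-1 <= cK ^+ 2.
  move=> hA _; rewrite -sqrt_half//.
  have := ubK _ (imageP _ hA); rewrite (colnorm_ball (ball_meas _ hA) (calA_norm_le1 t0 hA)) lee_fin.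
  by move=> e; rewrite lerXn2r ?nnegrE ?powR_ge0.
rewrite mulrC -ler_pdivlMr//.
have Q0 : 0 <= cK ^+ 2 / kappa q r K D by rewrite divr_ge0 ?sqr_ge0// ltW.
rewrite -(sqr_sqrtr Q0) lerXn2r ?nnegrE ?sqrtr_ge0 ?(le_trans cK0)//.
rewrite -lee_fin; apply: lub => _ [h [[mh _ _] hn] <-].
rewrite colnorm_ball// lee_fin -(@ler_pXn2r _ 2)// ?nnegrE ?powR_ge0 ?sqrtr_ge0//.
rewrite sqr_sqrtr// sqrt_half// ler_pdivlMr// mulrC.
exact: (dual_bound s0 q0 sq s1 K0 r01 (sqr_ge0 _) tX hB mh hn).
Qed.

End Family.

End Assemble.

(** * The choice of the radius *)

Section Numerics.
Context {R : realType}.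

(** With [x ^ 2 = (D + 1) / K] and [1 - r = 1 / sqrt (K (D + 1))], Bernoulli's inequality
    gives [r ^ (D + 1) >= 1 - x] and [r ^ K <= x], so each of the two factors of [kappa] loses
    at most a multiple of [x]. *)
Lemma kappa_lower (q : R) (K D : nat) : 1 <= q -> (D.+1 < K)%N ->
  exists2 r : R, 0 <= r < 1 & 1 - kappa q r K D <= 3 * Num.sqrt (D.+1%:R / K%:R).
Proof.
move=> q1 DK; set d := D.+1%:R : R; set k := K%:R : R.
have d0 : 0 < d by rewrite ltr0n.
have d1 : 1 <= d by rewrite ler1n.
have dk : d < k by rewrite ltr_nat.
have k0 : 0 < k := lt_trans d0 dk.
set x := Num.sqrt (d / k).
have x0 : 0 < x by rewrite sqrtr_gt0 divr_gt0.
have x2 : x ^+ 2 = d / k by rewrite sqr_sqrtr// divr_ge0 ?ltW.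
have x1 : x < 1 by rewrite -(@ltr_pXn2r _ 2)// ?nnegrE ?(ltW x0)// expr1n x2 ltr_pdivrMr// mul1r.
have x2k : x ^+ 2 * k = d by rewrite x2 divfK// gt_eqF.
pose delta := x / d.
have delta0 : 0 < delta by rewrite divr_gt0.
have dd : d * delta = x by rewrite /delta mulrC divfK// gt_eqF.
have kd : k * delta * x = 1.
  rewrite /delta; have -> : k * (x / d) * x = x ^+ 2 * k / d by ring.
  by rewrite x2k divff// gt_eqF.
have delta1 : delta < 1 by rewrite /delta ltr_pdivrMr// mul1r (lt_le_trans x1).
pose r := 1 - delta.
have r01 : 0 <= r < 1 by rewrite /r; apply/andP; split; lra.
exists r => //; have /andP[r0 r1] := r01.
have bern n : 1 - n%:R * delta <= r ^+ n.
  elim: n => [|n IH]; first by rewrite mul0r subr0 expr0.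
  rewrite exprS -natr1; have := ler_wpM2l r0 IH; rewrite /r.
  have : 0 <= n%:R * delta ^+ 2 by rewrite mulr_ge0 ?sqr_ge0.
  nra.
have bern2 n : 1 + n%:R * delta <= (1 + delta) ^+ n.
  elim: n => [|n IH]; first by rewrite mul0r addr0 expr0.
  rewrite exprS -natr1; have := ler_wpM2l (_ : 0 <= 1 + delta) IH.
  have : 0 <= n%:R * delta ^+ 2 by rewrite mulr_ge0 ?sqr_ge0.
  move=> h1 h2; have := h2 (addr_ge0 ler01 (ltW delta0)); nra.
have rho_le : r ^+ K <= x.
  have h : r ^+ K * (1 + delta) ^+ K <= 1.
    rewrite -exprMn exprn_ile1//; first by rewrite mulr_ge0// addr_ge0// ltW.
    by rewrite /r; nra.
  have h2 : r ^+ K * (k * delta) <= 1.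
    rewrite (le_trans _ h)// ler_wpM2l ?exprn_ge0// (le_trans _ (bern2 K))//.
    by rewrite lerDr.
  have := ler_wpM2r (ltW x0) h2; rewrite -mulrA kd mul1r mulr1//.
set rho := r ^+ K in rho_le *.
have rho0 : 0 <= rho by rewrite exprn_ge0.
rewrite /kappa -/rho.
set y := (1 - rho) / (1 + rho).
have y1 : y <= 1 by rewrite ler_pdivrMr; lra.
have y0 : 0 < y by rewrite divr_gt0; lra.
have y2 : 1 - 2 * rho <= y by rewrite ler_pdivlMr; nra.
have qi : 0 <= q^-1 <= 1 by rewrite invr_ge0 invf_le1 ?q1 ?(le_trans ler01 q1)// (lt_le_trans ltr01).
have /andP[qi0 qi1] := qi.
have yq : y <= y `^ q^-1 by rewrite ger1_powR// y0 y1.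
have z1 : y `^ q^-1 <= 1.
  have e : 1 `^ q^-1 = 1 :> R by rewrite powR1.
  by rewrite -[leRHS]e; apply: ge0_ler_powR; rewrite ?nnegrE ?(ltW y0).
have := bern D.+1; rewrite -/d dd => hd.
have w1 : r ^+ D.+1 <= 1 by rewrite exprn_ile1// ltW.
move: (y `^ q^-1) (r ^+ D.+1) yq z1 hd w1 => z w yq z1 hd w1.
nra.
Qed.

End Numerics.

Local Close Scope complex_scope.
Local Close Scope classical_set_scope.

Theorem theorem8p2 (R : realType) (p : R) (hp : 2 < p) :
  (exists2 M : R, 0 < M &
    forall (m : nat) (X : 'I_m -> {poly R[i]}) (D : nat),
      (exists j, X j != 0) ->
      (forall j, trig_deg_le D (fun w => `|(X j).[w]| ^+ 2)) ->
      (0 < scrC_oo (texp p) X)%E ->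
      forall K : nat, (1 <= K)%N ->
        (1 - scrC (texp p) X K ^+ 2 / scrC_oo (texp p) X ^+ 2 <=
         (M * Num.min 1
           ((Num.sqrt (D.+1%:R / K%:R) * ln (expR 1 * K%:R * D.+1%:R))
              `^ ((p - 2) / p)))%:E)%E)
  /\
  (exists2 M : R, 0 < M &
    forall (m : nat) (X : 'I_m -> {poly R[i]}) (D : nat),
      (exists j, X j != 0) ->
      (forall j, trig_deg_le D (fun w => `|(X j).[w]| ^+ 2)) ->
      (0 < scrC_oo (texp p) X)%E ->
      forall (eta : R) (K : nat), 0 < eta -> (1 <= K)%N ->
        M * D.+1%:R * eta `^ (- (2 * p / (p - 2)))
          * ln (expR 1 * K%:R * D.+1%:R) ^+ 2 <= K%:R ->
        (`|scrC_oo (texp p) X ^+ 2 - scrC (texp p) X K ^+ 2|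
           / scrC_oo (texp p) X ^+ 2 <= eta%:E)%E).
Proof.
have p0 : 0 < p by rewrite (lt_trans _ hp).
have p20 : 0 < p - 2 by rewrite subr_gt0.
pose s := p / (p - 2); pose q := p / 2; pose al := (p - 2) / p.
have tE : texp p = 2 * s by rewrite /texp /s mulrA.
have s1 : 1 <= s by rewrite ler_pdivlMr// mul1r gerBl.
have q1 : 1 <= q by rewrite ler_pdivlMr// mul1r ltW.
have q0 : 0 < q := lt_le_trans ltr01 q1.
have sq : s^-1 + q^-1 = 1 by rewrite /s /q; field; rewrite !gt_eqF.
have al0 : 0 < al by rewrite divr_gt0.
have al1 : al <= 1 by rewrite ler_pdivrMr// mul1r gerBl.
pose bound (D K : nat) : R := Num.sqrt (D.+1%:R / K%:R) * ln (expR 1 * K%:R * D.+1%:R).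
have L1 (D K : nat) : (1 <= K)%N -> 1 <= ln (expR 1 * K%:R * D.+1%:R) :> R.
  move=> K1; rewrite -[leLHS](expRK 1) ler_ln ?posrE ?mulr_gt0 ?expR_gt0 ?ltr0n//.
  by rewrite -mulrA ler_peMr ?expR_ge0// -natrM ler1n muln_gt0 K1.
have main m (X : 'I_m -> {poly R[i]}) D :
    (forall j, trig_deg_le D (fun w => `|(X j).[w]| ^+ 2)) ->
    (0 < scrC_oo (texp p) X)%E -> forall K, (1 <= K)%N ->
    exists coo cK : R, [/\ scrC_oo (texp p) X = coo%:E, scrC (texp p) X K = cK%:E,
      0 < coo, 0 <= cK <= coo &
      1 - cK ^+ 2 / coo ^+ 2 <= 3 * Num.min 1 (bound D K `^ al)].
  rewrite tE => tX oo0 K K1.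
  have [coo [cK [e1 e2 e3 hr]]] := scrC_ratio s1 q0 sq K1 tX.
  exists coo, cK; split=> //; first by rewrite -lte_fin -e1.
  have coo0 : 0 < coo by rewrite -lte_fin -e1.
  have c2 : 0 < coo ^+ 2 by rewrite exprn_gt0.
  have le1 : 1 - cK ^+ 2 / coo ^+ 2 <= 1 by rewrite gerBl divr_ge0 ?sqr_ge0.
  have LK := L1 D K K1.
  (* For [K <= D + 1] the minimum is one and the left-hand side is trivially at most one. *)
  have [KD|DK] := leqP K D.+1.
    have b1 : 1 <= bound D K `^ al.
      have e : 1 `^ al = 1 :> R by rewrite powR1.
      rewrite -[leLHS]e; apply: ge0_ler_powR; rewrite ?nnegrE ?(ltW al0)//.
        by rewrite mulr_ge0 ?sqrtr_ge0// (le_trans ler01).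
      rewrite -[leLHS]mulr1 ler_pM//.
      rewrite -[leLHS]sqrtr1 ler_wsqrtr// ler_pdivlMr ?ltr0n// mul1r ler_nat//.
    by rewrite min_l// mulr1 (le_trans le1)// ler1n.
  have [r r01 hk] := kappa_lower q1 DK.
  have x0 : 0 < Num.sqrt (D.+1%:R / K%:R) :> R by rewrite sqrtr_gt0 divr_gt0 ?ltr0n.
  have x1 : Num.sqrt (D.+1%:R / K%:R) <= 1 :> R.
    by rewrite -[leRHS]sqrtr1 ler_wsqrtr// ler_pdivrMr ?ltr0n// mul1r ler_nat ltnW.
  have h : 1 - cK ^+ 2 / coo ^+ 2 <= 3 * Num.sqrt (D.+1%:R / K%:R).
    rewrite (le_trans _ hk)// lerD2l lerN2 ler_pdivlMr//; exact: hr.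
  rewrite (le_trans h)// ler_wpM2l// le_min x1/=.
  rewrite (@le_trans _ _ (Num.sqrt (D.+1%:R / K%:R) `^ al))//.
    by rewrite ger1_powR// x0.
  apply: ge0_ler_powR; rewrite ?nnegrE ?(ltW al0) ?(ltW x0)//.
    by rewrite mulr_ge0 ?(ltW x0)// (le_trans ler01).
  by rewrite ler_peMr// ltW.
split.
  exists 3 => // m X D _ tX oo0 K K1.
  have [coo [cK [-> -> coo0 _ hb]]] := main m X D tX oo0 K K1.
  by rewrite -!EFin_expe inver gt_eqF ?exprn_gt0// -EFinM -EFinB lee_fin.
exists (3 `^ (2 / al)); first by rewrite powR_gt0.
move=> m X D _ tX oo0 eta K eta0 K1 hK.
have [coo [cK [-> -> coo0 /andP[cK0 cKoo] hb]]] := main m X D tX oo0 K K1.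
have c2 : 0 < coo ^+ 2 by rewrite exprn_gt0.
rewrite -!EFin_expe -EFinB abse_EFin inver gt_eqF// -EFinM lee_fin.
rewrite ger0_norm; last by rewrite subr_ge0 lerXn2r ?nnegrE// ltW.
rewrite mulrBl divff ?gt_eqF// (le_trans hb)//.
have LK := L1 D K K1; have k0 : 0 < K%:R :> R by rewrite ltr0n.
rewrite (@le_trans _ _ (3 * bound D K `^ al))//.
  by rewrite ler_wpM2l// ge_min lexx orbT.
have b0 : 0 <= bound D K by rewrite mulr_ge0 ?sqrtr_ge0// (le_trans ler01).
have ax : 2 / al = 2 * p / (p - 2) by rewrite /al; field; rewrite !gt_eqF.
(* Raising to the power [2 / al] turns the claim into the hypothesis on [K]. *)
have b2 : bound D K ^+ 2 <= (eta / 3) `^ (2 / al).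
  rewrite div_powR ?(ltW eta0)// exprMn sqr_sqrtr ?divr_ge0//.
  move: hK; rewrite -ax powRN.
  have E0 : 0 < eta `^ (2 / al) by rewrite powR_gt0.
  have T0 : 0 < 3 `^ (2 / al) :> R by rewrite powR_gt0.
  move: (eta `^ _) (3 `^ _) (ln _) E0 T0 => E T L E0 T0 hK.
  rewrite ler_pdivlMr//.
  have -> : D.+1%:R / K%:R * L ^+ 2 * T = T * D.+1%:R * L ^+ 2 / K%:R by ring.
  rewrite ler_pdivrMr// [E * _]mulrC -ler_pdivrMr//; apply: le_trans hK.
  by rewrite le_eqVlt; apply/orP; left; apply/eqP; ring.
suff : bound D K `^ al <= eta / 3 by rewrite ler_pdivlMr// mulrC.
have -> : eta / 3 = ((eta / 3) `^ (2 / al)) `^ (al / 2).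
  rewrite -powRrM; have -> : 2 / al * (al / 2) = 1 by field; rewrite gt_eqF.
  by rewrite powRr1// divr_ge0// ltW.
have -> : bound D K `^ al = (bound D K ^+ 2) `^ (al / 2).
  by rewrite -powR_mulrn// -powRrM; congr (_ `^ _); field.
by apply: ge0_ler_powR; rewrite ?nnegrE ?sqr_ge0 ?powR_ge0// divr_ge0// ltW.
Qed.
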